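(* Let $f \in \mathbb{C}[x^{\pm 1}, y^{\pm 1}]$ be an irreducible Laurent polynomial with Newton polygon $\Delta(f)$, and let $U(f) \subset \mathbb{T}^2$ be the curve defined by $f$. Then the gonality of $U(f)$ is at most $\mathrm{lw}(\Delta(f))$. If $\Delta(f)$ is equivalent to $d\Sigma$ for some integer $d \geq 2$, or to $2\Upsilon$, then the gonality of $U(f)$ is at most $\mathrm{lw}(\Delta(f)) - 1$.
   Context: $\mathbb{T}^2 = (\mathbb{C}\setminus\{0\})^2$. For an irreducible Laurent polynomial $f$, $U(f)\subset \mathbb{T}^2$ is the curve it defines, i.e. its zero locus. The gonality of $U(f)$ is the gonality of its complete non-singular model, i.e. the minimal degree of a non-constant rational map from $U(f)$ to $\mathbb{P}^1$. The Newton polygon $\Delta(f)$ is the convex hull in $\mathbb{R}^2$ of the exponent vectors of the monomials appearing in $f$ with non-zero coefficient. A lattice polygon is the convex hull in $\mathbb{R}^2$ of a finite subset of $\mathbb{Z}^2$. A $\mathbb{Z}$-affine transformation is a map $\mathbb{R}^2\to\mathbb{R}^2: x \mapsto Ax+b$ with $A \in \mathrm{GL}_2(\mathbb{Z})$ and $b \in \mathbb{Z}^2$. Two lattice polygons $\Delta,\Delta'$ are equivalent ($\Delta\cong\Delta'$) if $\varphi(\Delta)=\Delta'$ for some $\mathbb{Z}$-affine transformation $\varphi$. The lattice width $\mathrm{lw}(\Delta)$ of a non-empty lattice polygon $\Delta$ is the smallest integer $s\ge 0$ such that there is a $\mathbb{Z}$-affine transformation $\varphi$ with $\varphi(\Delta)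 \subset \{(x,y)\in\mathbb{R}^2 \mid 0\le y\le s\}$. For an integer $d\ge 0$, $d\Delta$ is the $d$-th Minkowski multiple of $\Delta$. $\Sigma = \mathrm{Conv}\{(0,0),(1,0),(0,1)\}$ is the standard $2$-simplex and $\Upsilon = \mathrm{Conv}\{(-1,-1),(1,0),(0,1)\}$.
   Formalization: The bound by lw(Δ(f)) is stated only when Δ(f) is two-dimensional; otherwise it fails, e.g. f = x − 1 has lw(Δ(f)) = 0 while U(f) has gonality 1. The second bound is unrestricted. *)

(* Defs.v *)
From HB Require Import structures.
From mathcomp Require Import all_boot all_order all_algebra.
From mathcomp Require Import finmap monalg complex.
From mathcomp Require Import boolp classical_sets reals.

Set Implicit Arguments.
Unset Strict Implicit.
Unset Printing Implicit Defensive.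

Import Order.TTheory GRing.Theory Num.Theory.

Local Open Scope classical_set_scope.
Local Open Scope ring_scope.

(** * The ring of Laurent polynomials in two variables

    The ring structure that [monalg] puts on [{malg C[M]}] excludes monoids [M]
    with nontrivial units, hence [M = Z^2], so it is rebuilt here on an alias.
    The exponent vector of x^a y^b is the column vector (a, b). *)

Definition laurent (C : nzRingType) : Type := {malg C['cV[int]_2]}.

Section LaurentRing.
Variable C : comNzRingType.
Implicit Types f g h : {malg C['cV[int]_2]}.

Definition laurent_mul f g : {malg C['cV[int]_2]} :=
  \sum_(m <- msupp f) \sum_(n <- msupp g) << f@_m * g@_n *g (m + n)%R >>.

Lemma laurent_mulw (d1 d2 : {fset 'cV[int]_2}) f g :
  (msupp f `<=` d1)%fset -> (msupp g `<=` d2)%fset ->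
  laurent_mul f g
  = \sum_(m <- d1) \sum_(n <- d2) << f@_m * g@_n *g (m + n)%R >>.
Proof.
move=> le1 le2; rewrite /laurent_mul (big_fset_incl _ le1) /=.
  apply/eq_bigr => m _; apply/big_fset_incl => // n _ /mcoeff_outdom ->.
  by rewrite mulr0 monalgU0.
move=> m _ /mcoeff_outdom fm.
by rewrite big1 // => n _; rewrite fm mul0r monalgU0.
Qed.

Lemma laurent_mulC : commutative laurent_mul.
Proof.
move=> f g; rewrite /laurent_mul exchange_big /=.
by apply/eq_bigr => m _; apply/eq_bigr => n _; rewrite mulrC addrC.
Qed.

Lemma laurent_mulUU (a b : C) (m n : 'cV[int]_2) :
  laurent_mul << a *g m >> << b *g n >> = << a * b *g (m + n)%R >>.
Proof. by rewrite (laurent_mulw msuppU_le msuppU_le) !big_seq_fset1 !mcoeffUU. Qed.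

Lemma laurent_mulDl : left_distributive laurent_mul +%R.
Proof.
move=> f g h.
rewrite (laurent_mulw (msuppD_le f g) (fsubset_refl (msupp h))).
rewrite (laurent_mulw (fsubsetUl _ (msupp g)) (fsubset_refl (msupp h))).
rewrite (laurent_mulw (fsubsetUr (msupp f) _) (fsubset_refl (msupp h))).
rewrite -big_split /=; apply/eq_bigr => m _.
rewrite -big_split /=; apply/eq_bigr => n _.
by rewrite mcoeffD mulrDl monalgUD.
Qed.

Lemma laurent_mulDr : right_distributive laurent_mul +%R.
Proof. by move=> f g h; rewrite !(laurent_mulC f) laurent_mulDl. Qed.

Lemma laurent_mul0l : left_zero 0 laurent_mul.
Proof. by move=> f; rewrite /laurent_mul msupp0 big_seq_fset0. Qed.

Lemma laurent_mul0r : right_zero 0 laurent_mul.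
Proof. by move=> f; rewrite laurent_mulC laurent_mul0l. Qed.

Lemma laurent_mul_suml (I : Type) (r : seq I) (F : I -> {malg C['cV[int]_2]}) g :
  laurent_mul (\sum_(i <- r) F i) g = \sum_(i <- r) laurent_mul (F i) g.
Proof.
exact: (big_morph (laurent_mul^~ g) (fun _ _ => laurent_mulDl _ _ _)
         (laurent_mul0l g)).
Qed.

Lemma laurent_mul_sumr (I : Type) (r : seq I) (F : I -> {malg C['cV[int]_2]}) f :
  laurent_mul f (\sum_(i <- r) F i) = \sum_(i <- r) laurent_mul f (F i).
Proof.
exact: (big_morph (laurent_mul f) (fun _ _ => laurent_mulDr _ _ _)
         (laurent_mul0r f)).
Qed.

Lemma laurent_mulA : associative laurent_mul.
Proof.
move=> f g h; rewrite [f]monalgE !laurent_mul_suml; apply/eq_bigr => k _.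
rewrite [g]monalgE laurent_mul_suml !laurent_mul_sumr laurent_mul_suml.
apply/eq_bigr => m _; rewrite [h]monalgE !laurent_mul_sumr.
by apply/eq_bigr => n _; rewrite !laurent_mulUU mulrA addrA.
Qed.

Lemma laurent_mul1 : left_id << 1 *g (0 : 'cV[int]_2) >> laurent_mul.
Proof.
move=> f; rewrite [f in LHS]monalgE laurent_mul_sumr [RHS]monalgE.
by apply/eq_bigr => m _; rewrite laurent_mulUU mul1r add0r.
Qed.

Lemma laurent_1neq0 : << 1 *g (0 : 'cV[int]_2) >> != 0 :> {malg C['cV[int]_2]}.
Proof. by rewrite monalgU_eq0 oner_eq0. Qed.

HB.instance Definition _ := GRing.Zmodule.copy (laurent C) {malg C['cV[int]_2]}.
HB.instance Definition _ := GRing.Zmodule_isComNzRing.Build (laurent C)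
  laurent_mulA laurent_mulC laurent_mul1 laurent_mulDl laurent_1neq0.

End LaurentRing.

Definition laurentC (C : nzRingType) (c : C) : laurent C :=
  << c *g (0 : 'cV[int]_2) >>.

Definition laurent_eval (C : fieldType) (f : laurent C) (x y : C) : C :=
  \sum_(m <- msupp f) f@_m * x ^ (m 0 0) * y ^ (m 1 0).

Definition invertible_elt (A : comNzRingType) (u : A) : Prop :=
  exists v, u * v = 1.

Definition irreducible_elt (A : comNzRingType) (f : A) : Prop :=
  [/\ f <> 0, ~ invertible_elt f &
      forall g h, f = g * h -> invertible_elt g \/ invertible_elt h].

(** * Curves in the torus and their gonality *)

Definition torus_curve (C : fieldType) (f : laurent C) : set (C * C) :=
  [set p | [/\ p.1 != 0, p.2 != 0 & laurent_eval f p.1 p.2 = 0]].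

(** [K] is the function field of the curve U(f): [phi] induces an embedding in
    [K] of the coordinate ring of U(f), i.e. of Laurent polynomials modulo those
    vanishing on U(f), and [K] is the field of fractions of its image. *)
Definition is_function_field (C : fieldType) (f : laurent C) (K : fieldType)
    (phi : {rmorphism laurent C -> K}) : Prop :=
  (forall g, phi g = 0 <->
     forall p, torus_curve f p -> laurent_eval g p.1 p.2 = 0) /\
  (forall z : K, exists g h, phi h != 0 /\ z = phi g / phi h).

(** For a subfield [E] of [K]: [K] has dimension [d] over [E]. *)
Definition extension_degree (K : fieldType) (E : set K) (d : nat) : Prop :=
  exists b : 'I_d -> K, forall z : K,
    exists! c : {ffun 'I_d -> K},
      (forall i, E (c i)) /\ z = \sum_(i < d) c i * b i.

Section RationalMaps.
Variables (C : fieldType) (K : fieldType) (phi : {rmorphism laurent C -> K}).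

Definition constants : set K := [set phi (laurentC c) | c in [set: C]].

Definition eval_in (p : {poly C}) (t : K) : K :=
  (map_poly (fun c => phi (laurentC c)) p).[t].

(** The subfield C(t) of [K]. *)
Definition simple_subfield (t : K) : set K :=
  [set z | exists p q : {poly C},
     eval_in q t != 0 /\ z = eval_in p t / eval_in q t].

End RationalMaps.

(** A non-constant rational map from U(f) to P^1 is a non-constant element [t]
    of the function field, and its degree is the degree of the function field
    over C(t). *)
Definition has_rational_map_of_degree (C : fieldType) (f : laurent C)
    (d : nat) : Prop :=
  exists (K : fieldType) (phi : {rmorphism laurent C -> K}) (t : K),
    [/\ is_function_field f phi, ~ constants phi t &
        extension_degree (simple_subfield phi t) d].

Definition is_gonality (C : fieldType) (f : laurent C) (g : nat) : Prop :=
  has_rational_map_of_degree f g /\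
  forall d, has_rational_map_of_degree f d -> (g <= d)%N.

(** * Lattice polygons *)

Definition vec2 (T : Type) (a b : T) : 'cV[T]_2 :=
  \col_(i < 2) (if i == 0 then a else b).

Section Polygons.
Variable R : realType.
Implicit Types A B : set 'cV[R]_2.

Definition conv_hull A : set 'cV[R]_2 :=
  [set x | exists (n : nat) (p : 'I_n -> 'cV[R]_2) (w : 'I_n -> R),
     [/\ forall i, A (p i), forall i, 0 <= w i, \sum_i w i = 1 &
         x = \sum_i w i *: p i]].

Definition minkowski_multiple (d : nat) A : set 'cV[R]_2 :=
  [set x | exists p : 'I_d -> 'cV[R]_2,
     (forall i, A (p i)) /\ x = \sum_i p i].

Definition Sigma : set 'cV[R]_2 :=
  conv_hull [set vec2 0 0; vec2 1 0; vec2 0 1].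

Definition Upsilon : set 'cV[R]_2 :=
  conv_hull [set vec2 (-1) (-1); vec2 1 0; vec2 0 1].

Definition Zaffine (M : 'M[int]_2) (b : 'cV[int]_2) (x : 'cV[R]_2) : 'cV[R]_2 :=
  map_mx intr M *m x + map_mx intr b.

(** [M \in unitmx] over [int] means that [M] belongs to GL_2(Z). *)
Definition equivalent A B : Prop :=
  exists (M : 'M[int]_2) (b : 'cV[int]_2),
    M \in unitmx /\ Zaffine M b @` A = B.

Definition fits_in_strip A (s : nat) : Prop :=
  exists (M : 'M[int]_2) (b : 'cV[int]_2),
    M \in unitmx /\
    Zaffine M b @` A `<=` [set x | 0 <= x 1 0 /\ x 1 0 <= s%:R].

(** The default value 0 is only used for unbounded [A]. *)
Definition lattice_width A : nat :=
  xget 0%N [set s | fits_in_strip A s /\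
                    forall s', fits_in_strip A s' -> (s <= s')%N].

(** [A] is not contained in a line. A segment such as the Newton polygon of
    x - 1 has lattice width 0, whereas a gonality is always at least 1. *)
Definition two_dimensional A : Prop :=
  exists p q r, [/\ A p, A q, A r &
    \det (row_mx (q - p) (r - p) : 'M[R]_(1 + 1)) != 0].

Definition newton_polygon (f : laurent R[i]) : set 'cV[R]_2 :=
  conv_hull [set map_mx intr m | m in [set m | m \in msupp f]].

End Polygons.

Arguments Sigma R : clear implicits.
Arguments Upsilon R : clear implicits.

(* Main.v *)
From HB Require Import structures.
From mathcomp Require Import all_boot all_order all_algebra.
From mathcomp Require Import generic_quotient ring_quotient fraction.
From mathcomp Require Import finmap monalg complex.
From mathcomp Require Import boolp classical_sets reals.
From mathcomp Require Import ring zify.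
Require Import Defs.

Set Implicit Arguments.
Unset Strict Implicit.
Unset Printing Implicit Defensive.

Import Order.TTheory GRing.Theory Num.Theory.

Local Open Scope classical_set_scope.
Local Open Scope ring_scope.

(** Why the theorem holds.  Let K be the function field of U(f).  If K is
    generated over C by t and s, with t nonconstant, and P(t, s) = 0 for some
    nonzero polynomial P, then K is spanned over C(t) by the powers of s below
    the degree of P in s ([degree_bound], [rational_map_bound]): this bounds the
    degree of the rational map t.  Each bound on the gonality is a choice of
    such a pair (t, s), after a Z-affine change of exponents, which replaces f
    by an associate of its image under a monomial automorphism and does not
    affect the function field ([rational_map_affine_change]).

    - If the Newton polygon lies in the strip between heights 0 and w, then f
      itself is a relation of degree at most w in y between x and y
      ([strip_bound]).
    - If the Newton polygon is d Sigma, the curve is a plane curve of degree d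
      and the lattice width is d.  Projecting from a point at infinity of the
      curve, i.e. taking t = y - c x where the top form of f vanishes at (1, c),
      kills the term of degree d in x of the relation ([simplex_bound]).
    - The lattice width of 2 Upsilon is 4.  The ten lattice points of
      2 Upsilon are the sums of two of the four lattice points of Upsilon, so f
      is a quadratic form in 1, x, y and z = 1 / (x y): the map (z : x : y : 1)
      puts the curve in the intersection of a quadric with the cubic surface
      z x y = 1.  Over C the quadric is ruled: f = l1 l2 - l3 l4 for some linear
      forms ([upsilon2_factor]).  The lines l1 = t l3, l4 = t l2 of a ruling meet
      the cubic in three points, so t = l1 / l3 has degree at most 3
      ([quadric_line], [upsilon2_bound]).

    That K exists, and that the chosen t is not constant, both rest on one fact:
    a Laurent polynomial that vanishes on U(f) is a multiple of f, and f is
    prime ([vanishing_divides], [irreducible_prime]).  It gives K as the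
    fraction field of the quotient by the ideal of the curve.  Since widths add
    up in products ([height_divides]), a nonzero multiple of f is at least as
    wide as f, so that a Laurent polynomial of small width, such as x - c, does
    not vanish on the curve.

    Finally, the gonality exists because some rational map does
    ([exists_rational_map]), and then it is a minimum of natural numbers. *)

(** * Monomials and substitutions in the Laurent polynomial ring *)

Definition monomial (C : nzRingType) (m : 'cV[int]_2) : laurent C := << 1 *g m >>.

Section LaurentMorphisms.
Variable C : comNzRingType.
Implicit Types (f g : laurent C) (m n : 'cV[int]_2).

Lemma termM (a b : C) m n :
  (<< a *g m >> : laurent C) * << b *g n >> = << a * b *g (m + n)%R >>.
Proof. exact: laurent_mulUU. Qed.

Lemma monomialD m n : monomial C (m + n) = monomial C m * monomial C n.
Proof. by rewrite /monomial termM mulr1. Qed.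

Lemma monomial0 : monomial C 0 = 1. Proof. by []. Qed.

Lemma laurentC_is_zmod_morphism : zmod_morphism (@laurentC C).
Proof. by move=> a b; rewrite /laurentC monalgUB. Qed.

Lemma laurentC_is_monoid_morphism : monoid_morphism (@laurentC C).
Proof. by split=> // a b; rewrite /laurentC termM addr0. Qed.

HB.instance Definition _ := GRing.isZmodMorphism.Build C (laurent C)
  (@laurentC C) laurentC_is_zmod_morphism.
HB.instance Definition _ := GRing.isMonoidMorphism.Build C (laurent C)
  (@laurentC C) laurentC_is_monoid_morphism.

Lemma termE (a : C) m : << a *g m >> = laurentC a * monomial C m.
Proof. by rewrite /laurentC /monomial termM mulr1 add0r. Qed.

Lemma mcoeff_laurentM g h k : (g * h)@_k =
  \sum_(m <- msupp g) \sum_(n <- msupp h) (g@_m * h@_n) *+ (m + n == k).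
Proof.
rewrite [g * h]/(laurent_mul g h) /laurent_mul raddf_sum /=; apply: eq_bigr => m _.
by rewrite raddf_sum /=; apply: eq_bigr => n _; rewrite mcoeffU.
Qed.

Section Substitution.
Variables (S : comNzRingType) (j : {rmorphism C -> S}) (h : 'cV[int]_2 -> S).
Hypothesis h0 : h 0 = 1.
Hypothesis hD : forall m n, h (m + n) = h m * h n.

Lemma laurent_subst_term (a : C) m : mmap j h << a *g m >> = j a * h m.
Proof. exact: mmapU. Qed.

Lemma laurent_subst_zmod_morphism : zmod_morphism (mmap j h : laurent C -> S).
Proof. by move=> f g; exact: (raddfB (mmap j h : {additive {malg C['cV[int]_2]} -> S})). Qed.

(** The universal property of the Laurent polynomial ring: evaluation at points,
    and changes of variables, are both instances of it. *)
Lemma laurent_subst_monoid_morphism : monoid_morphism (mmap j h : laurent C -> S).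
Proof.
split=> [|f g].
  by rewrite -monomial0 laurent_subst_term h0 rmorph1 mulr1.
rewrite [f * g]/(laurent_mul f g) /laurent_mul (mmapE _ _ f) (mmapE _ _ g).
rewrite raddf_sum /= mulr_suml; apply: eq_bigr => m _.
rewrite raddf_sum /= mulr_sumr; apply: eq_bigr => n _.
by rewrite laurent_subst_term rmorphM hD mulrACA.
Qed.
End Substitution.
End LaurentMorphisms.

(** * Polynomials in two variables inside the Laurent polynomial ring *)

Section Evaluation.
Variables (C S : comNzRingType) (j : {rmorphism C -> S}).

Definition poly_eval (t : S) (p : {poly C}) : S := (map_poly j p).[t].

Lemma poly_eval_is_zmod_morphism t : zmod_morphism (poly_eval t).
Proof. by move=> p q; rewrite /poly_eval rmorphB hornerD hornerN. Qed.
Lemma poly_eval_is_monoid_morphism t : monoid_morphism (poly_eval t).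
Proof.
by split=> [|p q]; rewrite /poly_eval ?rmorph1 ?hornerC // rmorphM hornerM.
Qed.
HB.instance Definition _ t := GRing.isZmodMorphism.Build {poly C} S
  (poly_eval t) (poly_eval_is_zmod_morphism t).
HB.instance Definition _ t := GRing.isMonoidMorphism.Build {poly C} S
  (poly_eval t) (poly_eval_is_monoid_morphism t).

Lemma poly_evalC t c : poly_eval t c%:P = j c.
Proof. by rewrite /poly_eval map_polyC hornerC. Qed.
Lemma poly_evalX t : poly_eval t 'X = t.
Proof. by rewrite /poly_eval map_polyX hornerX. Qed.
End Evaluation.

Section Evaluation2.
Variables (C S : comNzRingType) (j : {rmorphism C -> S}) (t s : S).

(** A polynomial in two variables is an element of [{poly {poly C}}]; its inner
    variable is sent to [t] and its outer variable to [s]. *)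
Definition poly2_eval (P : {poly {poly C}}) : S :=
  poly_eval (poly_eval j t) s P.
HB.instance Definition _ := GRing.RMorphism.copy poly2_eval (poly_eval (poly_eval j t) s).

Lemma poly2_evalC p : poly2_eval p%:P = poly_eval j t p.
Proof. exact: poly_evalC. Qed.
Lemma poly2_evalX : poly2_eval 'X = s.
Proof. exact: poly_evalX. Qed.
Lemma poly2_evalE P : poly2_eval P = \sum_(i < size P) poly_eval j t P`_i * s ^+ i.
Proof.
rewrite /poly2_eval [in LHS]/poly_eval (horner_coef_wide _ (size_poly _ _)).
by apply: eq_bigr => i _; rewrite coef_map.
Qed.
End Evaluation2.

Lemma eq_poly_eval (C S : comNzRingType) (j j' : {rmorphism C -> S}) t :
  j =1 j' -> poly_eval j t =1 poly_eval j' t.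
Proof. by move=> jj' p; rewrite /poly_eval (eq_map_poly jj'). Qed.

Lemma eq_poly2_eval (C S : comNzRingType) (j j' : {rmorphism C -> S}) t s :
  j =1 j' -> poly2_eval j t s =1 poly2_eval j' t s.
Proof. by move=> jj' p; apply: eq_poly_eval; apply: eq_poly_eval. Qed.

Lemma rmorph_poly_eval (C S S' : comNzRingType) (j : {rmorphism C -> S})
    (u : {rmorphism S -> S'}) t p :
  u (poly_eval j t p) = poly_eval (u \o j) (u t) p.
Proof. by rewrite /poly_eval map_poly_comp horner_map. Qed.

Lemma rmorph_poly2_eval (C S S' : comNzRingType) (j : {rmorphism C -> S})
    (u : {rmorphism S -> S'}) t s P :
  u (poly2_eval j t s P) = poly2_eval (u \o j) (u t) (u s) P.
Proof.
rewrite /poly2_eval rmorph_poly_eval; apply: eq_poly_eval => p /=.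
exact: rmorph_poly_eval.
Qed.

Definition polyCC (C : comNzRingType) : C -> {poly {poly C}} := polyC \o polyC.
HB.instance Definition _ C := GRing.RMorphism.copy (@polyCC C) (polyC \o polyC).

(** Substituting in two steps: this is how a relation between x and y becomes a
    relation between other generators of the function field. *)
Lemma poly2_eval_comp (C S : comNzRingType) (j : {rmorphism C -> S}) t s A B P :
  poly2_eval j t s (poly2_eval (@polyCC C) A B P)
  = poly2_eval j (poly2_eval j t s A) (poly2_eval j t s B) P.
Proof.
rewrite rmorph_poly2_eval; apply: eq_poly2_eval => c /=.
by rewrite /polyCC /= poly2_evalC poly_evalC.
Qed.

Section LaurentPoly.
Variable C : comNzRingType.
Implicit Types (g : laurent C) (m : 'cV[int]_2).

Lemma vec2_0 (T : Type) (a b : T) i : vec2 a b 0 i = a.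
Proof. by rewrite mxE. Qed.
Lemma vec2_1 (T : Type) (a b : T) i : vec2 a b 1 i = b.
Proof. by rewrite mxE. Qed.
Definition vec2K := (vec2_0, vec2_1).
Lemma vec2_eta (T : Type) (m : 'cV[T]_2) : m = vec2 (m 0 0) (m 1 0).
Proof.
apply/colP; case=> [[|[|//]] lti]; rewrite mxE //=; congr (m _ _); exact: val_inj.
Qed.
Lemma vec2_eqP (T : Type) (m n : 'cV[T]_2) : m 0 0 = n 0 0 -> m 1 0 = n 1 0 -> m = n.
Proof. by move=> h0 h1; rewrite (vec2_eta m) (vec2_eta n) h0 h1. Qed.
Lemma vec2Z_eqP (m n : 'cV[int]_2) : m 0 0 = n 0 0 -> m 1 0 = n 1 0 -> m = n.
Proof. exact: vec2_eqP. Qed.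
Lemma vec2D (V : zmodType) (a b c d : V) : vec2 a b + vec2 c d = vec2 (a + c) (b + d).
Proof. by apply: vec2_eqP; rewrite !mxE. Qed.

Definition varx : laurent C := monomial C (vec2 1 0).
Definition vary : laurent C := monomial C (vec2 0 1).

Lemma varxX n : varx ^+ n = monomial C (vec2 n%:Z 0).
Proof.
elim: n => [|n IH].
  by rewrite expr0 -monomial0; congr monomial; apply: vec2_eqP; rewrite !mxE.
by rewrite exprS IH -monomialD vec2D addr0; congr (monomial _ (vec2 _ _)); lia.
Qed.

Lemma varyX n : vary ^+ n = monomial C (vec2 0 n%:Z).
Proof.
elim: n => [|n IH].
  by rewrite expr0 -monomial0; congr monomial; apply: vec2_eqP; rewrite !mxE.
by rewrite exprS IH -monomialD vec2D addr0; congr (monomial _ (vec2 _ _)); lia.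
Qed.

Definition of_poly2 (P : {poly {poly C}}) : laurent C :=
  poly2_eval (@laurentC C) varx vary P.
HB.instance Definition _ := GRing.RMorphism.copy of_poly2
  (poly2_eval (@laurentC C) varx vary).

Lemma of_poly2_monom (c : C) i k :
  of_poly2 ((c *: 'X^i)%:P * 'X^k) = << c *g vec2 i%:Z k%:Z >>.
Proof.
rewrite rmorphM /= /of_poly2 poly2_evalC rmorphXn /= poly2_evalX -mul_polyC.
rewrite rmorphM /= poly_evalC rmorphXn /= poly_evalX varxX varyX -mulrA -monomialD.
by rewrite vec2D addr0 add0r -termE.
Qed.

Definition nonneg_supp g := forall m, m \in msupp g -> 0 <= m 0 0 /\ 0 <= m 1 0.

Definition to_poly2 g : {poly {poly C}} :=
  \sum_(m <- msupp g) (g@_m *: 'X^`|m 0%R 0%R|%N)%:P * 'X^`|m 1%R 0%R|%N.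

Lemma to_poly2K g : nonneg_supp g -> of_poly2 (to_poly2 g) = g.
Proof.
move=> g0; rewrite [RHS]monalgE /to_poly2 raddf_sum /=.
rewrite !big_seq; apply: eq_bigr => m /g0 [m0 m1]; rewrite of_poly2_monom.
by rewrite (gez0_abs m0) (gez0_abs m1) -vec2_eta.
Qed.

Lemma sum_mcoeff_eq g (k : 'cV[int]_2) : \sum_(m <- msupp g) g@_m *+ (m == k) = g@_k.
Proof.
by rewrite [in RHS](monalgE g) raddf_sum /=; apply: eq_bigr => m _; rewrite mcoeffU.
Qed.

Lemma coef_to_poly2 g i k : nonneg_supp g ->
  (to_poly2 g)`_k`_i = g@_(vec2 i%:Z k%:Z).
Proof.
move=> g0; rewrite -sum_mcoeff_eq /to_poly2 !coef_sum !big_seq.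
apply: eq_bigr => m /g0 [m0 m1].
rewrite coefCM coefXn mulr_natr coefMn coefZ coefXn mulr_natr -mulrnA.
congr (_ *+ _); rewrite mulnb; congr (nat_of_bool _).
apply/andP/eqP => [[/eqP i0 /eqP k1]|->]; last by rewrite !vec2K.
by apply: vec2_eqP; rewrite !vec2K ?i0 ?k1 gez0_abs.
Qed.

Lemma mcoeff_monomialM b g k : (monomial C b * g)@_k = g@_(k - b).
Proof.
rewrite -(sum_mcoeff_eq g (k - b)) [in LHS](monalgE g) mulr_sumr raddf_sum /=.
apply: eq_bigr => m _; rewrite termM mcoeffU mul1r; congr (_ *+ (nat_of_bool _)).
by rewrite [RHS]eq_sym subr_eq eq_sym addrC.
Qed.

Lemma msupp_monomialM b g k : (k \in msupp (monomial C b * g)) = (k - b \in msupp g).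
Proof. by rewrite -!mcoeff_neq0 mcoeff_monomialM. Qed.

Lemma nonneg_shift g : exists n : nat, nonneg_supp (monomial C (vec2 n%:Z n%:Z) * g).
Proof.
exists (\sum_(m <- msupp g) (`|m 0%R 0%R| + `|m 1%R 0%R|))%N => m.
rewrite msupp_monomialM => mg.
set n := (X in vec2 X%:Z _) in mg *.
pose k : 'cV[int]_2 := m - vec2 n%:Z n%:Z.
have: (`|k 0%R 0%R| + `|k 1%R 0%R| <= n)%N.
  by rewrite /n (big_fsetD1 k mg) /= leq_addr.
by rewrite /k !mxE /=; lia.
Qed.

Lemma to_poly2_eq0 g : nonneg_supp g -> (to_poly2 g == 0) = (g == 0).
Proof.
move=> g0; apply/eqP/eqP => [h|->]; last by rewrite /to_poly2 msupp0 big_seq_fset0.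
by rewrite -(to_poly2K g0) h rmorph0.
Qed.

Lemma monomialK b : monomial C (- b) * monomial C b = 1.
Proof. by rewrite -monomialD addNr. Qed.

Lemma monomial_unit b : invertible_elt (monomial C b).
Proof. by exists (monomial C (- b)); rewrite mulrC monomialK. Qed.

End LaurentPoly.

(** * Divisibility and values at points of the torus *)

Definition divides (A : comNzRingType) (f g : A) : Prop := exists q, g = f * q.

Section Divisibility.
Variable A : comNzRingType.
Implicit Types f g h u : A.

Lemma divides_trans f g h : divides f g -> divides g h -> divides f h.
Proof. by move=> [q ->] [r ->]; exists (q * r); rewrite mulrA. Qed.
Lemma divides_mulr f g h : divides f g -> divides f (g * h).
Proof. by move=> [q ->]; exists (q * h); rewrite mulrA. Qed.
Lemma divides_mull f g h : divides f g -> divides f (h * g).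
Proof. by rewrite mulrC; apply: divides_mulr. Qed.
Lemma divides_add f g h : divides f g -> divides f h -> divides f (g + h).
Proof. by move=> [q ->] [r ->]; exists (q + r); rewrite mulrDr. Qed.
Lemma divides_unitl f g u : invertible_elt u -> divides f (u * g) -> divides f g.
Proof.
move=> [v uv] [q uq]; exists (v * q).
by rewrite mulrCA -uq mulrA [v * u]mulrC uv mul1r.
Qed.
Lemma invertibleM u v : invertible_elt u -> invertible_elt v -> invertible_elt (u * v).
Proof. by move=> [u' uu] [v' vv]; exists (u' * v'); rewrite mulrACA uu vv mulr1. Qed.
End Divisibility.

Section UnivariateRoots.
Variable C : closedFieldType.
Implicit Types p : {poly C}.

(** [p * 'X] has a nonroot, which is then nonzero: coordinates on the torus must
    avoid 0. *)
Lemma poly_nonroot p : p != 0 -> exists2 a, a != 0 & p.[a] != 0.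
Proof.
move=> p0; have /closed_nonrootP [a] : p * 'X != 0 by rewrite mulf_neq0 ?polyX_eq0.
by rewrite rootE hornerM hornerX mulf_eq0 negb_or => /andP[? ?]; exists a.
Qed.

(** Dividing by a power of the variable, [p] gets a nonzero constant term while
    staying nonconstant. *)
Lemma poly_root_neq0 p i k : i != k -> p`_i != 0 -> p`_k != 0 ->
  exists2 a, a != 0 & root p a.
Proof.
elim/poly_ind: p i k => [|p c IH] i k ik; first by rewrite coef0 eqxx.
have [->|c0] := eqVneq c 0; last first.
  move=> pi pk; have /closed_rootP [a ra] : size (p * 'X + c%:P) != 1%N.
    rewrite neq_ltn; apply/orP; right.
    have [j j0 pj] : exists2 j, (0 < j)%N & (p * 'X + c%:P)`_j != 0.
      case: i ik pi => [|i] ik pi; last by exists i.+1.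
      by exists k; rewrite // lt0n eq_sym.
    by apply: leq_trans (_ : (j.+1 <= _)%N); rewrite // ltnNge;
       apply: contra pj => /leq_sizeP -> //.
  exists a => //; apply: contraNneq c0 => a0.
  by move: ra; rewrite a0 rootE !hornerE.
rewrite addr0 !coefMX; case: i ik => [|i] ik /=; first by rewrite eqxx.
move=> pi; case: k ik => [|k] ik /=; first by rewrite eqxx.
by move=> pk; have [a a0 ra] := IH i k ik pi pk; exists a; rewrite // rootM ra.
Qed.

End UnivariateRoots.

Section Points.
Variable C : closedFieldType.
Implicit Types (g h : laurent C) (P : {poly {poly C}}) (a b c : C).

Local Notation x := (varx C).
Local Notation y := (vary C).

Definition poly2_at a b P : C := poly2_eval (idfun : {rmorphism C -> C}) a b P.
HB.instance Definition _ a b := GRing.RMorphism.copy (poly2_at a b)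
  (poly2_eval (idfun : {rmorphism C -> C}) a b).

Lemma poly2_atE a b P : poly2_at a b P = (map_poly (horner_eval a) P).[b].
Proof.
rewrite /poly2_at /poly2_eval [LHS]/poly_eval; congr (_.[b]).
by apply: eq_map_poly => p /=; rewrite /poly_eval /horner_eval /= map_poly_id.
Qed.

Lemma poly2_nonroot P : P != 0 ->
  exists a b, [/\ a != 0, b != 0 & poly2_at a b P != 0].
Proof.
rewrite -lead_coef_eq0 => /poly_nonroot [a a0 pa].
have /poly_nonroot [b b0 pb] : map_poly (horner_eval a) P != 0.
  apply: contra_neq pa => /(congr1 (fun p : {poly C} => p`_(size P).-1)).
  by rewrite coef_map coef0.
by exists a, b; rewrite poly2_atE.
Qed.

Section AtPoint.
Variables (a b : C) (a0 : a != 0) (b0 : b != 0).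
Let h (m : 'cV[int]_2) := a ^ (m 0 0) * b ^ (m 1 0).
Let hD m n : h (m + n) = h m * h n.
Proof. by rewrite /h !mxE !expfzDr // mulrACA. Qed.
Let h0 : h 0 = 1. Proof. by rewrite /h !mxE mulr1. Qed.

Definition laurent_at : {rmorphism laurent C -> C} :=
  HB.pack (mmap idfun h : laurent C -> C)
    (GRing.isZmodMorphism.Build _ _ _ (laurent_subst_zmod_morphism idfun h))
    (GRing.isMonoidMorphism.Build _ _ _
       (laurent_subst_monoid_morphism idfun h0 hD)).

Lemma laurent_atE g : laurent_at g = laurent_eval g a b.
Proof.
rewrite /laurent_eval /laurent_at /=.
by rewrite mmapE; apply: eq_bigr => m _; rewrite mulrA.
Qed.

Lemma laurent_at_of_poly2 P : laurent_at (of_poly2 P) = poly2_at a b P.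
Proof.
rewrite /of_poly2 rmorph_poly2_eval /poly2_at.
have -> : laurent_at (x) = a.
  by rewrite /varx /= laurent_subst_term /h !vec2K /= mul1r expr1z expr0z mulr1.
have -> : laurent_at (y) = b.
  by rewrite /vary /= laurent_subst_term /h !vec2K /= mul1r expr1z expr0z mul1r.
apply: eq_poly2_eval => c /=.
by rewrite laurent_subst_term /h !mxE !expr0z !mulr1.
Qed.
End AtPoint.

Lemma of_poly2_rep g : exists u P, invertible_elt u /\ u * g = of_poly2 P.
Proof.
have [n gn] := nonneg_shift g; pose u := monomial C (vec2 n%:Z n%:Z).
exists u, (to_poly2 (u * g)); split; first exact: monomial_unit.
by rewrite to_poly2K.
Qed.

End Points.

(** * The Nullstellensatz for an irreducible curve in the torus *)

(** Induction on a factorization into linear factors. *)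
Lemma closed_poly_ind (C : closedFieldType) (Q : {poly C} -> Prop) :
  (forall c, c != 0 -> Q c%:P) ->
  (forall q c, q != 0 -> Q q -> Q (q * ('X - c%:P))) ->
  forall p, p != 0 -> Q p.
Proof.
move=> QC QX p; have [n] := ubnP (size p); elim: n p => // n IH p pn p0.
have [/eqP/size_poly1P [c c0 ->]|/closed_rootP [c]] := eqVneq (size p) 1%N.
  exact: QC.
move=> /factor_theorem [q pq]; move: pn p0; rewrite pq.
have [->|q0] := eqVneq q 0; first by rewrite mul0r eqxx.
rewrite size_Mmonic ?monicXsubC // size_XsubC addn2 /= => qn _.
exact: QX (IH q qn q0).
Qed.

(** The ring A stands for the Laurent polynomial ring: a localization of the
    polynomial ring in x (inner variable) and y (outer variable) in which x and y
    are units, with its points. *)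
Section Torus.
Variables (C : closedFieldType) (A : comNzRingType).
Variable of_poly2 : {rmorphism {poly {poly C}} -> A}.
Variable at_pt : forall a b : C, a != 0 -> b != 0 -> {rmorphism A -> C}.
Hypothesis at_ptE : forall a b (a0 : a != 0) (b0 : b != 0) P,
  at_pt a0 b0 (of_poly2 P) = poly2_at a b P.
Hypothesis of_poly2_rep : forall g : A, exists u P,
  invertible_elt u /\ u * g = of_poly2 P.
Hypothesis x_unit : invertible_elt (of_poly2 'X%:P).
Hypothesis y_unit : invertible_elt (of_poly2 'X).
Implicit Types (f g h u : A) (P : {poly {poly C}}) (a b c : C).

Definition of_poly p : A := of_poly2 p%:P.
HB.instance Definition _ := GRing.RMorphism.copy of_poly (of_poly2 \o polyC).

Lemma invertible_mul_eq0 u g : invertible_elt u -> u * g = 0 -> g = 0.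
Proof. by move=> [v uv] e; rewrite -[g]mul1r -uv mulrAC e mul0r. Qed.

Lemma at_pt_unit a b (a0 : a != 0) (b0 : b != 0) u :
  invertible_elt u -> at_pt a0 b0 u != 0.
Proof.
move=> [v /(congr1 (at_pt a0 b0))]; rewrite rmorphM rmorph1.
by apply: contra_eq_neq => ->; rewrite mul0r eq_sym oner_eq0.
Qed.

Lemma of_poly2_inj : injective of_poly2.
Proof.
apply: raddf_inj => P e; apply/eqP; apply: contraT => /poly2_nonroot [a [b [a0 b0]]].
by rewrite -(at_ptE a0 b0) e rmorph0 eqxx.
Qed.

(** Clearing denominators reduces this to the polynomial ring in two variables. *)
Lemma torus_mulf_eq0 g h : g * h = 0 -> g = 0 \/ h = 0.
Proof.
have [u [P [uU uP]]] := of_poly2_rep g; have [v [Q [vU vQ]]] := of_poly2_rep h.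
move=> gh; have: P * Q = 0.
  by apply: of_poly2_inj; rewrite rmorphM rmorph0 /= -uP -vQ mulrACA gh mulr0.
move=> /eqP; rewrite mulf_eq0 => /orP[] /eqP e; [left|right].
  by apply: (invertible_mul_eq0 uU); rewrite uP e rmorph0.
by apply: (invertible_mul_eq0 vU); rewrite vQ e rmorph0.
Qed.

Lemma torus_mulfI f g h : f != 0 -> f * g = f * h -> g = h.
Proof.
move=> f0 /eqP; rewrite -subr_eq0 -mulrBr => /eqP /torus_mulf_eq0 [/eqP|/eqP].
  by rewrite (negbTE f0).
by rewrite subr_eq0 => /eqP.
Qed.

(** Up to units, and for c != 0, these are the irreducible elements that depend
    on x alone. *)
Definition vertical c : A := of_poly ('X - c%:P).

Lemma of_poly_at a b (a0 : a != 0) (b0 : b != 0) p : at_pt a0 b0 (of_poly p) = p.[a].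
Proof. by rewrite at_ptE poly2_atE map_polyC hornerC. Qed.

Lemma vertical_at a b (a0 : a != 0) (b0 : b != 0) c :
  at_pt a0 b0 (vertical c) = a - c.
Proof. by rewrite of_poly_at hornerXsubC. Qed.

(** After multiplication by a unit, every coefficient of the polynomial in y has
    the root [c]. *)
Lemma vertical_dividesP c g : c != 0 ->
  (forall b (c0 : c != 0) (b0 : b != 0), at_pt c0 b0 g = 0) ->
  divides (vertical c) g.
Proof.
move=> c0 g0; have [u [P [uU uP]]] := of_poly2_rep g.
apply: (divides_unitl uU); rewrite uP.
have Pc i : (P`_i).[c] = 0.
  have: map_poly (horner_eval c) P = 0.
    apply/eqP; apply: contraT => /poly_nonroot [b b0].
    rewrite -poly2_atE -(at_ptE c0 b0) -uP rmorphM.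
    by rewrite g0 mulr0 eqxx.
  by move=> /(congr1 (fun p : {poly C} => p`_i)); rewrite coef_map coef0.
pose Q := \poly_(i < size P) (P`_i %/ ('X - c%:P)).
exists (of_poly2 Q); rewrite /vertical /of_poly -rmorphM; apply: (congr1 of_poly2).
apply/polyP => i.
rewrite coefCM coef_poly; case: ltnP => [_|lei]; last first.
  by rewrite mulr0 nth_default.
by rewrite mulrC divpK // dvdp_XsubCl; apply/rootP; apply: Pc.
Qed.

(** The restriction to the line x = c is a polynomial ring in y, hence a domain:
    this is what Gauss's lemma comes down to over an algebraically closed field. *)
Lemma vertical_prime c g h : c != 0 ->
  divides (vertical c) (g * h) -> divides (vertical c) g \/ divides (vertical c) h.
Proof.
move=> c0 [q ghq].
have [u [P [uU uP]]] := of_poly2_rep g; have [v [Q [vU vQ]]] := of_poly2_rep h.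
pose ev P := map_poly (horner_eval c) P.
have [/eqP eP|eP] := boolP (ev P == 0).
  left; apply: (vertical_dividesP c0) => b c1 b0.
  have := at_ptE c1 b0 P; rewrite poly2_atE -/(ev P) eP horner0 -uP rmorphM.
  move=> /eqP; rewrite mulf_eq0 => /orP[|/eqP //].
  by rewrite (negbTE (at_pt_unit c1 b0 uU)).
have [/eqP eQ|eQ] := boolP (ev Q == 0).
  right; apply: (vertical_dividesP c0) => b c1 b0.
  have := at_ptE c1 b0 Q; rewrite poly2_atE -/(ev Q) eQ horner0 -vQ rmorphM.
  move=> /eqP; rewrite mulf_eq0 => /orP[|/eqP //].
  by rewrite (negbTE (at_pt_unit c1 b0 vU)).
have /poly_nonroot [b b0] : ev P * ev Q != 0 by rewrite mulf_neq0.
rewrite hornerM -!poly2_atE -!(at_ptE c0 b0) -uP -vQ -rmorphM.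
rewrite mulrACA ghq rmorphM [X in _ * X]rmorphM.
by rewrite vertical_at subrr mul0r mulr0 eqxx.
Qed.

Lemma of_poly_XsubC q c : of_poly (q * ('X - c%:P)) = of_poly q * vertical c.
Proof. exact: rmorphM. Qed.

Lemma vertical0_unit : invertible_elt (vertical 0).
Proof. by rewrite /vertical subr0. Qed.

Lemma vertical_neq0 c : vertical c != 0.
Proof.
have [a a0 ac] : exists2 a, a != 0 & ('X - c%:P).[a] != 0.
  by apply: poly_nonroot; rewrite polyXsubC_eq0.
apply: contra_neq ac => /(congr1 (at_pt a0 (oner_neq0 C))).
by rewrite vertical_at rmorph0 hornerXsubC.
Qed.

Lemma constant_unit c : c != 0 -> invertible_elt (of_poly c%:P).
Proof. by move=> c0; exists (of_poly c^-1%:P); rewrite -rmorphM -polyCM mulfV // rmorph1. Qed.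

Lemma vertical_nunit c : c != 0 -> ~ invertible_elt (vertical c).
Proof.
move=> c0 /(at_pt_unit c0 (oner_neq0 C)).
by rewrite vertical_at subrr eqxx.
Qed.

Section OneCurve.
Variables (f : A) (irrf : irreducible_elt f).

(** Units of the ring of Laurent polynomials over C(x), cleared of denominators. *)
Definition poly_times_unit g := exists d u,
  [/\ d != 0, invertible_elt u & g = of_poly d * u].

Lemma poly_times_unit_vertical c g :
  poly_times_unit g -> poly_times_unit (vertical c * g).
Proof.
move=> [d [u [d0 uU ->]]]; exists (d * ('X - c%:P)), u; split; [|exact: uU|].
  by rewrite mulf_neq0 ?polyXsubC_eq0.
by rewrite of_poly_XsubC -mulrA mulrCA.
Qed.

(** An irreducible [f] stays irreducible over C(x): the linear factors of [k]
    are distributed one by one between [g] and [h] by [vertical_prime]. *)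
Lemma irreducible_times_poly k g h : k != 0 -> of_poly k * f = g * h ->
  poly_times_unit g \/ poly_times_unit h.
Proof.
move=> k0; elim/closed_poly_ind: k / k0 g h => [c c0|q c q0 IH] g h.
  move=> e; have [v cv] := constant_unit c0.
  have fE : f = (v * g) * h.
    by rewrite -mulrA -e (mulrA v) (mulrC v) cv mul1r.
  case: irrf => _ _ /(_ _ _ fE) [vg|hU]; [left|right].
    exists c%:P, (v * g); split; [by rewrite polyC_eq0|exact: vg|].
    by rewrite mulrA cv mul1r.
  by exists 1, h; split; [rewrite oner_eq0|exact: hU|rewrite rmorph1 mul1r].
rewrite of_poly_XsubC -mulrA mulrCA => e.
have [c0|c0] := eqVneq c 0.
  have [v vU] := vertical0_unit; rewrite -c0 in vU.
  have e' : of_poly q * f = (v * g) * h.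
    by rewrite -mulrA -e (mulrA v) (mulrC v) vU mul1r.
  have [vg|hU] := IH _ _ e'; [left|by right].
  by have := poly_times_unit_vertical c vg; rewrite mulrA vU mul1r.
have : divides (vertical c) (g * h) by exists (of_poly q * f).
case/(vertical_prime c0) => -[r rE].
  have e' : of_poly q * f = r * h.
    by apply: (torus_mulfI (vertical_neq0 c)); rewrite e rE mulrA.
  by have [?|?] := IH _ _ e'; [left; rewrite rE; apply: poly_times_unit_vertical|right].
have e' : of_poly q * f = g * r.
  by apply: (torus_mulfI (vertical_neq0 c)); rewrite e rE mulrCA.
by have [?|?] := IH _ _ e'; [left|right; rewrite rE; apply: poly_times_unit_vertical].
Qed.

Hypothesis novert : forall c, c != 0 -> ~ divides (vertical c) f.

(** Divisibility over C(x) implies divisibility: the linear factors of [k] can be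
    cancelled one by one, since none of them divides [f]. *)
Lemma divides_times_poly k g : k != 0 -> divides f (of_poly k * g) -> divides f g.
Proof.
move=> k0; elim/closed_poly_ind: k / k0 g => [c c0|q c q0 IH] g.
  exact: divides_unitl (constant_unit c0).
rewrite of_poly_XsubC -mulrA => dfg; apply: (IH); move: dfg; rewrite mulrCA.
have [->|c0] := eqVneq c 0; first exact: (divides_unitl vertical0_unit).
move=> [r rE]; have : divides (vertical c) (f * r) by exists (of_poly q * g).
case/(vertical_prime c0) => [/(novert c0) //|[r' r'E]]; exists r'.
by apply: (torus_mulfI (vertical_neq0 c)); rewrite rE r'E mulrCA.
Qed.

(** Over C(x) the polynomials in y form a Euclidean domain.  An element [D] of
    least degree in y in the ideal of [f] and [g] divides both up to a factor in
    C[x]; by irreducibility it is, up to a unit, either a polynomial in x or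
    [f] itself. *)
Lemma divides_or_comaximal g : divides f g \/
  exists r u v, r != 0 /\ of_poly r = u * f + v * g.
Proof.
pose I h := exists u v, h = u * f + v * g.
have IM h k : I h -> I (k * h).
  by move=> [u [v ->]]; exists (k * u), (k * v); rewrite mulrDr !mulrA.
have IB h k : I h -> I k -> I (h - k).
  move=> [u [v ->]] [u' [v' ->]]; exists (u - u'), (v - v').
  by rewrite !mulrBl opprD addrACA.
have If : I f by exists 1, 0; rewrite mul1r mul0r addr0.
have Ig : I g by exists 0, 1; rewrite mul1r mul0r add0r.
have [m [F [[m' mm'] mF]]] := of_poly2_rep f.
have [n [G [[n' nn'] nG]]] := of_poly2_rep g.
have F0 : F != 0.
  apply/eqP => F0; move: mF; rewrite F0 rmorph0.
  have mU : invertible_elt m by exists m'.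
  by move=> /(invertible_mul_eq0 mU); case: irrf.
have exD : exists s : nat, `[< exists D : {poly {poly C}}, [/\ D != 0, size D = s & I (of_poly2 D)] >].
  by exists (size F); apply/asboolP; exists F; split; rewrite // -mF; apply: IM.
(* D has least degree in y among the nonzero elements of the ideal I. *)
case: (ex_minnP exD) => s /asboolP [D [D0 Ds ID]] smin.
have Ddiv P : I (of_poly2 P) ->
    exists k Q, k != 0 /\ of_poly k * of_poly2 P = Q * of_poly2 D.
  move=> IP; pose k := lead_coef D ^+ scalp P D.
  have k0 : k != 0 by rewrite expf_neq0 // lead_coef_eq0.
  have := Pdiv.Idomain.divp_eq P D; rewrite -/k -mul_polyC => dE.
  exists k, (of_poly2 (Pdiv.Idomain.divp P D)); split; first exact: k0.
  rewrite /of_poly -[RHS]rmorphM -[LHS]rmorphM; apply: (congr1 of_poly2); rewrite dE.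
  have [->|R0] := eqVneq (Pdiv.Idomain.modp P D) 0; first by rewrite addr0.
  have IR : I (of_poly2 (Pdiv.Idomain.modp P D)).
    have -> : Pdiv.Idomain.modp P D = k%:P * P - Pdiv.Idomain.divp P D * D.
      by rewrite dE addrC addKr.
    by rewrite rmorphB !rmorphM; apply: IB; apply: IM.
  have := Pdiv.Idomain.ltn_modp P D; rewrite D0 Ds ltnNge => /negP[].
  by apply: smin; apply/asboolP; exists (Pdiv.Idomain.modp P D); split.
have [k [Q [k0 kF]]] : exists k Q, k != 0 /\ of_poly k * f = Q * of_poly2 D.
  have [|k [Q [k0 kF]]] := Ddiv F; first by rewrite -mF; apply: IM.
  exists k, (m' * Q); split; first exact: k0.
  by rewrite -mulrA -kF -mF mulrCA (mulrA m') (mulrC m') mm' mul1r.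
have [k' [Q' [k'0 kG]]] : exists k Q, k != 0 /\ of_poly k * g = Q * of_poly2 D.
  have [|k' [Q' [k'0 kG]]] := Ddiv G; first by rewrite -nG; apply: IM.
  exists k', (n' * Q'); split; first exact: k'0.
  by rewrite -mulrA -kG -nG mulrCA (mulrA n') (mulrC n') nn' mul1r.
have [[d [w [d0 wU QE]]]|[d [w [d0 [v wv] DE]]]] := irreducible_times_poly k0 kF.
  left; apply: (divides_unitl wU); apply: (@divides_times_poly (d * k')).
    by rewrite mulf_neq0.
  exists (of_poly k * Q').
  have -> : of_poly (d * k') * (w * g) = (of_poly d * w) * (of_poly k' * g).
    by rewrite rmorphM mulrACA.
  by rewrite kG -QE mulrCA -kF mulrCA [RHS]mulrC mulrA.
right; exists d; have [u1 [v1 DI]] := ID.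
exists (v * u1), (v * v1); split; first exact: d0.
by rewrite -!mulrA -mulrDr -DI DE mulrCA (mulrC v) wv mulr1.
Qed.

(** If [f] has two coefficients in y that are nonzero at [a], then the equation
    for y above x = a has a nonzero root.  If [f] has only one coefficient in y,
    it is a polynomial in x up to a unit; its nonzero roots are excluded, and
    without nonzero roots it would be a unit. *)
Lemma exists_point r : r != 0 -> exists a b (a0 : a != 0) (b0 : b != 0),
  at_pt a0 b0 f = 0 /\ r.[a] != 0.
Proof.
move=> r0; have [m [F [mU mF]]] := of_poly2_rep f.
have F0 : F != 0.
  by apply/eqP => F0; move: mF; rewrite F0 rmorph0 => /(invertible_mul_eq0 mU); case: irrf.
pose k := (size F).-1.
have Fk : F`_k != 0 by rewrite -lead_coefE lead_coef_eq0.
have [[i [ik Fi]]|one] := pselect (exists i, i != k /\ F`_i != 0).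
  have [a a0] : exists2 a, a != 0 & (r * (F`_i * F`_k)).[a] != 0.
    by apply: poly_nonroot; rewrite !mulf_neq0.
  rewrite !hornerM !mulf_eq0 !negb_or => /and3P[ra Fia Fka].
  have [b b0 Fb] : exists2 b, b != 0 & root (map_poly (horner_eval a) F) b.
    by apply: (poly_root_neq0 ik); rewrite coef_map.
  exists a, b, a0, b0; split; last exact: ra.
  move: Fb; rewrite rootE -poly2_atE -(at_ptE a0 b0) -mF rmorphM mulf_eq0.
  by rewrite (negbTE (at_pt_unit a0 b0 mU)) => /eqP.
have FE : F = (F`_k)%:P * 'X^k.
  apply/polyP => i; rewrite coefCM coefXn.
  have [->|ik] := eqVneq i k; first by rewrite mulr1.
  by rewrite mulr0; apply/eqP; apply: contraT => Fi; case: one; exists i.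
have fE : m * f = of_poly F`_k * of_poly2 'X ^+ k.
  by rewrite mF [in LHS]FE rmorphM rmorphXn.
have [[c c0 Fc]|noroot] := pselect (exists2 c, c != 0 & root F`_k c).
  case: (novert c0); apply: (divides_unitl mU); rewrite fE.
  have [q ->] := factor_theorem _ _ Fc.
  by rewrite of_poly_XsubC mulrAC; apply: divides_mull; exists 1; rewrite mulr1.
pose l := (size F`_k).-1.
have Fkl : F`_k`_l != 0 by rewrite -lead_coefE lead_coef_eq0.
have FkE : F`_k = (F`_k`_l)%:P * 'X^l.
  apply/polyP => i; rewrite coefCM coefXn.
  have [->|il] := eqVneq i l; first by rewrite mulr1.
  rewrite mulr0; apply/eqP; apply: contraT => Fi; case: noroot.
  exact: poly_root_neq0 il Fi Fkl.
have expU u j : invertible_elt u -> invertible_elt (u ^+ j).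
  move=> uU; elim: j => [|j IH]; first by exists 1; rewrite mulr1.
  by rewrite exprS; apply: invertibleM.
case: irrf => _ + _; case.
have [v mv] := mU; have -> : f = v * (m * f) by rewrite mulrA (mulrC v) mv mul1r.
rewrite fE FkE; apply: invertibleM; first by exists m; rewrite mulrC.
apply: invertibleM; last exact: expU.
rewrite rmorphM rmorphXn; apply: invertibleM; first exact: constant_unit.
exact: expU.
Qed.
End OneCurve.

Section Nullstellensatz.
Variables (f : A) (irrf : irreducible_elt f).

(** Curves of the form x = c are treated apart, because they do not dominate the
    x-axis. *)
Lemma vertical_or_novert :
  (exists c u, [/\ c != 0, invertible_elt u & f = vertical c * u]) \/
  (forall c, c != 0 -> ~ divides (vertical c) f).
Proof.
have [[c [c0 [u fE]]]|no] := pselect (exists c, c != 0 /\ divides (vertical c) f).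
  left; exists c, u; split => //; case: irrf => _ _ /(_ _ _ fE) [|//].
  by move=> /(vertical_nunit c0).
by right=> c c0 cf; apply: no; exists c.
Qed.

(** If [f] did not divide [g], then a nonzero polynomial in x would vanish on the
    curve by [divides_or_comaximal], against [exists_point]. *)
Lemma vanishing_divides g :
  (forall a b (a0 : a != 0) (b0 : b != 0), at_pt a0 b0 f = 0 -> at_pt a0 b0 g = 0) ->
  divides f g.
Proof.
move=> g0; case: vertical_or_novert => [[c [u [c0 [v uv] fE]]]|novert].
  have [q gq] : divides (vertical c) g.
    apply: (vertical_dividesP c0) => b c1 b0; apply: g0.
    by rewrite fE rmorphM vertical_at subrr mul0r.
  by exists (v * q); rewrite fE gq -mulrA (mulrA u) uv mul1r.
case: (divides_or_comaximal irrf novert g) => // -[r [u [v [r0 rE]]]].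
have [a [b [a0 [b0 [fab]]]]] := exists_point irrf novert r0.
rewrite -(of_poly_at a0 b0) rE rmorphD !rmorphM fab (g0 _ _ _ _ fab).
by rewrite !mulr0 addr0 eqxx.
Qed.

Lemma irreducible_prime g h : divides f (g * h) -> divides f g \/ divides f h.
Proof.
case: vertical_or_novert => [[c [u [c0 uU fE]]]|novert].
  have cf k : divides (vertical c) k -> divides f k.
    by move=> [q ->]; have [v uv] := uU; exists (v * q); rewrite fE -mulrA (mulrA u) uv mul1r.
  move=> fgh; have /(vertical_prime c0) [] : divides (vertical c) (g * h).
  - by apply: divides_trans fgh; exists u.
  - by move=> /cf; left.
  - by move=> /cf; right.
case: (divides_or_comaximal irrf novert g) => [|[r [u [v [r0 rE]]]]]; first by left.
move=> [q gh]; right; apply: (divides_times_poly novert r0).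
by rewrite rE; exists (u * h + v * q); rewrite mulrDl mulrDr -!mulrA gh; congr (_ + _);
   rewrite mulrCA.
Qed.

End Nullstellensatz.
End Torus.

(** * The function field of the curve *)

Section PrimeQuotient.
Variables (A : comNzRingType) (I : prime_idealr A).

Definition prime_quot : Type := {ideal_quot I}.
HB.instance Definition _ := GRing.ComNzRing.on prime_quot.

Definition prime_quot_unit : pred prime_quot := fun u => `[< exists v, v * u = 1 >].
(** Units and inverses in the quotient are obtained from classical choice. *)
Definition prime_quot_inv (u : prime_quot) : prime_quot :=
  if pselect (exists v, v * u = 1) is left e then projT1 (cid e) else u.

Lemma prime_quot_mulVr : {in prime_quot_unit, left_inverse 1 prime_quot_inv *%R}.
Proof.
move=> u /asboolP uU; rewrite /prime_quot_inv; case: pselect => // e.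
by case: cid.
Qed.
Lemma prime_quot_unitP (u v : prime_quot) : v * u = 1 -> prime_quot_unit u.
Proof. by move=> uv; apply/asboolP; exists v. Qed.
Lemma prime_quot_inv_out : {in [predC prime_quot_unit], prime_quot_inv =1 id}.
Proof.
move=> u /asboolP uU; rewrite /prime_quot_inv; by case: pselect.
Qed.
HB.instance Definition _ := GRing.ComNzRing_hasMulInverse.Build prime_quot
  prime_quot_mulVr prime_quot_unitP prime_quot_inv_out.

Lemma prime_quot_idomain : GRing.integral_domain_axiom prime_quot.
Proof. exact: Quotient.rquot_IdomainAxiom. Qed.
HB.instance Definition _ := GRing.ComUnitRing_isIntegral.Build prime_quot
  prime_quot_idomain.

Definition residue (g : A) : {fraction prime_quot} :=
  tofrac (\pi_({ideal_quot I})%qT g : prime_quot).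

Lemma residue_is_zmod_morphism : zmod_morphism residue.
Proof. by move=> g h; rewrite /residue rmorphB -tofracB. Qed.
Lemma residue_is_monoid_morphism : monoid_morphism residue.
Proof.
split=> [|g h]; rewrite /residue; first by rewrite rmorph1 tofrac1.
by rewrite rmorphM -tofracM.
Qed.
HB.instance Definition _ := GRing.isZmodMorphism.Build A {fraction prime_quot}
  residue residue_is_zmod_morphism.
HB.instance Definition _ := GRing.isMonoidMorphism.Build A {fraction prime_quot}
  residue residue_is_monoid_morphism.

Lemma residue_eq0 g : residue g = 0 <-> g \in I.
Proof.
rewrite -[g]subr0 Quotient.idealrBE subr0; split=> [/eqP|/eqP e].
  by rewrite tofrac_eq0 -[0 : prime_quot](rmorph0 (\pi_({ideal_quot I})%qT)).
by apply/eqP; rewrite tofrac_eq0; apply/eqP; rewrite e rmorph0.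
Qed.

Lemma residue_fraction z : exists g h, residue h != 0 /\ z = residue g / residue h.
Proof.
elim/quotW: z => r; exists (repr (\n_r)), (repr (\d_r)).
have E (q : prime_quot) : residue (repr q) = tofrac q by rewrite /residue reprK.
have d0 : tofrac (\d_r) != 0 by rewrite tofrac_eq0 denom_ratioP.
rewrite !E; split=> //; apply: (mulIf d0); rewrite mulfVK //.
unlock FracField.tofrac; rewrite -[LHS]FracField.pi_mul; apply/eqmodP.
by rewrite /= FracField.equivfE /FracField.mulf !numden_Ratio
  ?mulr1 ?oner_eq0 ?denom_ratioP // mulrC.
Qed.
End PrimeQuotient.

Lemma prime_residue_field (A : comNzRingType) (f : A) :
  ~ invertible_elt f ->
  (forall g h, divides f (g * h) -> divides f g \/ divides f h) ->
  exists (K : fieldType) (phi : {rmorphism A -> K}),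
    (forall g, phi g = 0 <-> divides f g) /\
    (forall z, exists g h, phi h != 0 /\ z = phi g / phi h).
Proof.
move=> fU fprime; pose I : pred A := fun g => `[< divides f g >].
have Iideal : idealr_closed I.
  split; first by apply/asboolP; exists 0; rewrite mulr0.
    by apply/negP => /asboolP [v fv]; apply: fU; exists v.
  move=> a u v /asboolP fu /asboolP fv; apply/asboolP.
  by apply: divides_add => //; apply: divides_mull.
have Iprime : prime_idealr_closed I.
  move=> u v /asboolP /fprime [fu|fv]; apply/orP; [left|right]; exact/asboolP.
pose P : prime_idealr A := HB.pack I (isIdealr.Build A I Iideal)
  (isPrimeIdealrClosed.Build A I Iprime).
exists {fraction (prime_quot P)}, (@residue A P); split=> [g|]; last exact: residue_fraction.
by rewrite residue_eq0; split => [/asboolP|?] //; apply/asboolP.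
Qed.

Section FunctionField.
Variable C : closedFieldType.
Variables (f : laurent C) (irrf : irreducible_elt f).

Let x_unit : invertible_elt (of_poly2 ('X%:P : {poly {poly C}})).
Proof. by rewrite /of_poly2 poly2_evalC poly_evalX; apply: monomial_unit. Qed.
Let y_unit : invertible_elt (of_poly2 ('X : {poly {poly C}})).
Proof. by rewrite /of_poly2 poly2_evalX; apply: monomial_unit. Qed.

Lemma torus_curve_vanishing g :
  (forall p, torus_curve f p -> laurent_eval g p.1 p.2 = 0) <-> divides f g.
Proof.
split=> [g0|[q gq] [a b] /= [/= a0 b0 fab]]; last first.
  by rewrite gq -(laurent_atE a0 b0) rmorphM [X in X * _]laurent_atE fab mul0r.
apply: (vanishing_divides (@laurent_at_of_poly2 C) (@of_poly2_rep C) x_unit y_unit irrf).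
move=> a b a0 b0; rewrite !laurent_atE => fab.
by apply: (g0 (a, b)); split.
Qed.

(** In this form, being the function field of [f] is transported by automorphisms
    of the Laurent polynomial ring. *)
Lemma function_fieldP (K : fieldType) (phi : {rmorphism laurent C -> K}) :
  is_function_field f phi <->
  (forall g, phi g = 0 <-> divides f g) /\
  (forall z, exists g h, phi h != 0 /\ z = phi g / phi h).
Proof.
split=> -[fK frac]; split; move=> // g.
  by rewrite fK; apply: torus_curve_vanishing.
by rewrite fK; split=> /torus_curve_vanishing.
Qed.

Lemma function_field_exists :
  exists (K : fieldType) (phi : {rmorphism laurent C -> K}), is_function_field f phi.
Proof.
have [||K [phi Kphi]] := @prime_residue_field (laurent C) f; first by case: irrf.
  exact: (irreducible_prime (@laurent_at_of_poly2 C) (@of_poly2_rep C) x_unit irrf).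
by exists K, phi; apply/function_fieldP.
Qed.
End FunctionField.

(** * The degree over C(t) of a field generated by two elements *)

Section SimpleExtension.
Variables (C : closedFieldType) (K : fieldType) (j : {rmorphism C -> K}) (t s : K).

(** Over an algebraically closed field a vanishing polynomial expression in [t]
    has a vanishing linear factor. *)
Lemma nonconstant_transcendental :
  (forall c, t <> j c) -> forall p, p != 0 -> poly_eval j t p != 0.
Proof.
move=> tC p p0; elim/closed_poly_ind: p / p0 => [c c0|q c q0 IH].
  by rewrite poly_evalC fmorph_eq0.
rewrite rmorphM mulf_neq0 // rmorphB /= poly_evalX poly_evalC subr_eq0.
by apply/eqP.
Qed.

(** The subfield C(t), stated with [poly_eval] so as to be convertible with
    [simple_subfield]. *)
Definition rational_in : set K := [set z | exists p q : {poly C},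
  poly_eval j t q != 0 /\ z = poly_eval j t p / poly_eval j t q].

Local Notation ev := (poly2_eval j t s).
Local Notation ev1 := (poly_eval j t).

(** Membership in the subfield C(t, s). *)
Definition generated (z : K) := exists A B, ev B != 0 /\ z = ev A / ev B.

Lemma generated_eval A : generated (ev A).
Proof. by exists A, 1; rewrite rmorph1 oner_eq0 divr1. Qed.

Lemma generatedM z w : generated z -> generated w -> generated (z * w).
Proof.
move=> [A [B [B0 ->]]] [A' [B' [B'0 ->]]]; exists (A * A'), (B * B').
by rewrite !rmorphM mulf_neq0 // mulf_div.
Qed.
Lemma generatedD z w : generated z -> generated w -> generated (z + w).
Proof.
move=> [A [B [B0 ->]]] [A' [B' [B'0 ->]]]; exists (A * B' + A' * B), (B * B').
by rewrite rmorphD !rmorphM mulf_neq0 // addf_div.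
Qed.
Lemma generatedV z : generated z -> generated z^-1.
Proof.
move=> [A [B [B0 ->]]]; have [->|A0] := eqVneq (ev A) 0.
  by rewrite mul0r invr0 -(rmorph0 ev); apply: generated_eval.
by exists B, A; rewrite invf_div.
Qed.
Lemma generated_sum (I : eqType) (r : seq I) (F : I -> K) :
  (forall i, i \in r -> generated (F i)) -> generated (\sum_(i <- r) F i).
Proof.
move=> rF; rewrite big_seq; elim/big_rec: _ => [|i z ri]; last first.
  by apply: generatedD; apply: rF.
by rewrite -(rmorph0 ev); apply: generated_eval.
Qed.
Lemma generated_expz z (n : int) : generated z -> generated (z ^ n).
Proof.
have gX k w : generated w -> generated (w ^+ k).
  move=> gw; elim: k => [|k IH]; last by rewrite exprS; apply: generatedM.
  by rewrite expr0 -(rmorph1 ev); apply: generated_eval.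
move=> gz; case: n => n; first exact: gX.
by rewrite -[z ^ _]/((z ^+ n.+1)^-1); apply/generatedV/gX.
Qed.
Lemma generated_const c : generated (j c).
Proof.
by have := generated_eval c%:P%:P; rewrite poly2_evalC poly_evalC.
Qed.
Lemma generated_fst : generated t.
Proof. by have := generated_eval 'X%:P; rewrite poly2_evalC poly_evalX. Qed.
Lemma generated_snd : generated s.
Proof. by have := generated_eval 'X; rewrite poly2_evalX. Qed.

Lemma poly2_eval_wide n (P : {poly {poly C}}) : (size P <= n)%N ->
  ev P = \sum_(i < n) ev1 P`_i * s ^+ i.
Proof.
move=> Pn; rewrite poly2_evalE (big_ord_widen n (fun i => ev1 P`_i * s ^+ i) Pn).
rewrite big_mkcond; apply: eq_bigr => i _.
by case: ltnP => // Pi; rewrite [P`_i] nth_default // rmorph0 mul0r.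
Qed.

Hypothesis t_trans : forall p, p != 0 -> ev1 p != 0.

Lemma common_denominator d (c : 'I_d -> K) : (forall i, rational_in (c i)) ->
  exists (q : {poly C}) (p : 'I_d -> {poly C}),
    q != 0 /\ forall i, c i = ev1 (p i) / ev1 q.
Proof.
move=> cE; have [p /choice [q pq]] := choice cE.
exists (\prod_i q i), (fun i => p i * \prod_(k | k != i) q k).
have q0 i : ev1 (q i) != 0 by have [] := pq i.
have q'0 i : q i != 0.
  by apply: contraNneq (q0 i) => ->; rewrite rmorph0.
split; first by apply/prodf_neq0 => i _.
move=> i; rewrite [X in _ / ev1 X](bigD1 i) //= !rmorphM; have [_ ->] := pq i.
rewrite -mulf_div divff ?mulr1 //.
by apply: t_trans; apply/prodf_neq0 => k _.
Qed.

Variable P : {poly {poly C}}.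
Hypotheses (P0 : P != 0) (evP : ev P = 0).
Hypothesis gen : forall z, generated z.

(** The minimal polynomial of [s] over C(t), with denominators cleared. *)
Lemma exists_minimal_relation : exists Q : {poly {poly C}}, [/\ Q != 0, ev Q = 0, (size Q <= size P)%N &
  forall B : {poly {poly C}}, B != 0 -> (size B < size Q)%N -> ev B != 0].
Proof.
have exQ : exists n : nat, `[< exists Q : {poly {poly C}}, [/\ Q != 0, size Q = n & ev Q = 0] >].
  by exists (size P); apply/asboolP; exists P.
case: (ex_minnP exQ) => n /asboolP [Q [Q0 Qn evQ]] minQ.
exists Q; split => //.
  by rewrite Qn; apply: minQ; apply/asboolP; exists P.
move=> B B0; rewrite Qn ltnNge; apply: contraNneq => evB.
by apply: minQ; apply/asboolP; exists B.
Qed.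

Section Minimal.
Variable Q : {poly {poly C}}.
Hypotheses (Q0 : Q != 0) (evQ : ev Q = 0).
Hypothesis minQ : forall B : {poly {poly C}}, B != 0 -> (size B < size Q)%N -> ev B != 0.

Lemma size_minimal_gt1 : (1 < size Q)%N.
Proof.
rewrite ltnNge; apply/negP => /size1_polyC QE.
move: evQ Q0; rewrite QE poly2_evalC polyC_eq0 => e q0.
by have := t_trans q0; rewrite e eqxx.
Qed.

(** Pseudo-division by [Q] leaves a denominator in C[t]. *)
Lemma ev_reduce A : exists k (R : {poly {poly C}}),
  [/\ k != 0, (size R < size Q)%N & ev1 k * ev A = ev R].
Proof.
exists (lead_coef Q ^+ scalp A Q), (Pdiv.Idomain.modp A Q); split.
- by rewrite expf_neq0 // lead_coef_eq0.
- by rewrite Pdiv.Idomain.ltn_modp.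
rewrite -(poly2_evalC j t s) -rmorphM mul_polyC Pdiv.Idomain.divp_eq.
by rewrite rmorphD rmorphM /= evQ mulr0 add0r.
Qed.

(** The extended Euclidean algorithm for [Q] and [B]; by minimality of [Q], the
    remainders do not vanish before they become constant. *)
Lemma ev_inverse (B : {poly {poly C}}) : B != 0 -> (size B < size Q)%N ->
  exists k B', k != 0 /\ ev B * ev B' = ev1 k.
Proof.
have [n] := ubnP (size B); elim: n B => // n IH B Bn B0 BQ.
have [B1|B1] := leqP (size B) 1.
  have BE := size1_polyC B1; exists (B`_0), 1.
  by split; [rewrite -polyC_eq0 -BE|rewrite rmorph1 mulr1 [in LHS]BE poly2_evalC].
have e := Pdiv.Idomain.divp_eq Q B.
set T := Pdiv.Idomain.divp Q B in e; set R := Pdiv.Idomain.modp Q B in e.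
have RB : (size R < size B)%N by rewrite Pdiv.Idomain.ltn_modp.
have evTR : ev T * ev B + ev R = 0.
  by rewrite -rmorphM -rmorphD -e -mul_polyC rmorphM /= evQ mulr0.
have k0 : lead_coef B ^+ scalp Q B != 0 by rewrite expf_neq0 // lead_coef_eq0.
have R0 : R != 0.
  apply/eqP => R0; move: e evTR; rewrite R0 rmorph0 !addr0 => e /eqP.
  have T0 : T != 0.
    apply/eqP => T0; move/eqP: e; rewrite T0 mul0r -mul_polyC mulf_eq0 polyC_eq0.
    by rewrite (negbTE k0) (negbTE Q0).
  have TQ : (size T < size Q)%N.
    rewrite -(size_Cmul Q k0) mul_polyC e size_mul //.
    by case: (size B) B1 => [|[|b]] // _; rewrite !addnS ltnS leq_addr.
  by rewrite mulf_eq0 (negbTE (minQ T0 TQ)) (negbTE (minQ B0 BQ)).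
have [k [R' [k'0 RR']]] := IH R (leq_trans RB Bn) R0 (ltn_trans RB BQ).
exists k, (- T * R'); split; [exact: k'0|]; rewrite -[RHS]RR'.
rewrite [X in _ * X]rmorphM [X in _ * (X * _)]rmorphN /=.
move/eqP: evTR; rewrite addrC addr_eq0 => /eqP ->; ring.
Qed.

(** The powers of [s] below the degree of the minimal relation form a basis over
    C(t).  Any quotient reduces to a combination of them by [ev_inverse] and
    [ev_reduce]; two combinations with the same value differ, after clearing
    denominators, by a relation of too small a degree. *)
Lemma minimal_basis : extension_degree rational_in (size Q).-1.
Proof.
set d := (size Q).-1.
have dQ : (d < size Q)%N by rewrite /d prednK // ltnW // size_minimal_gt1.
exists (fun i => s ^+ i) => z.
have [A [B [B0 zE]]] := gen z.
have [k1 [R1 [k10 R1Q R1E]]] := ev_reduce B.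
have R10 : R1 != 0.
  apply/eqP => R10; move/eqP: R1E; rewrite R10 rmorph0 mulf_eq0.
  by rewrite (negbTE (t_trans k10)) (negbTE B0).
have [k2 [B' [k20 B'E]]] := ev_inverse R10 R1Q.
have [k3 [R3 [k30 R3Q R3E]]] := ev_reduce (A * B' * k1%:P).
have zR : z = ev R3 / ev1 (k2 * k3).
  rewrite -R3E !rmorphM /= poly2_evalC zE -B'E -R1E.
  have := t_trans k10; have := t_trans k20; have := t_trans k30.
  rewrite -B'E mulf_eq0 negb_or => k30' /andP[R1' B'0] k10'.
  by field; rewrite B0 k10' B'0 k30'.
have k0 : ev1 (k2 * k3) != 0 by apply: t_trans; rewrite mulf_neq0.
have R3d : (size R3 <= d)%N by rewrite -ltnS prednK // ltnW // size_minimal_gt1.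
exists [ffun i : 'I_d => ev1 R3`_i / ev1 (k2 * k3)]; split.
  split=> [i|]; first by rewrite ffunE; exists R3`_i, (k2 * k3).
  rewrite zR (poly2_eval_wide R3d) mulr_suml; apply: eq_bigr => i _.
  by rewrite ffunE mulrAC.
move=> c [cE cz]; apply/ffunP => i0.
pose a (i : 'I_d) := ev1 R3`_(nat_of_ord i) / ev1 (k2 * k3).
have [q [p [q0 cpq]]] := common_denominator cE.
have aE i : rational_in (a i) by exists R3`_i, (k2 * k3).
have [q' [p' [q'0 apq]]] := common_denominator aE.
pose D := \sum_(i < d) (p i * q' - p' i * q)%:P * 'X^i.
have De (i : 'I_d) : D`_(nat_of_ord i) = p i * q' - p' i * q.
  rewrite coef_sum (bigD1 i) //= coefCM coefXn eqxx mulr1 big1 ?addr0 // => k ki.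
  by rewrite coefCM coefXn eq_sym (negbTE (ki : nat_of_ord k != i)) mulr0.
have Dd : (size D <= d)%N.
  apply: (leq_trans (size_sum _ _ _)); apply/bigmax_leqP => i _.
  apply: leq_trans (size_polyMleq _ _) _; rewrite size_polyXn addnS /=.
  by apply: leq_trans (leq_add (size_polyC_leq1 _) (leqnn _)) _; rewrite add1n.
have q1 := t_trans q0; have q1' := t_trans q'0.
have evD : ev D = 0.
  have -> : ev D = ev1 q * ev1 q' * (\sum_(i < d) c i * s ^+ i - \sum_(i < d) a i * s ^+ i).
    rewrite -sumrB mulr_sumr rmorph_sum; apply: eq_bigr => i _.
    rewrite rmorphM rmorphXn /= poly2_evalC poly2_evalX rmorphB !rmorphM /= cpq apq.
    by field; rewrite q1 q1'.
  rewrite -cz; apply/eqP; rewrite mulf_eq0 subr_eq0; apply/orP; right.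
  rewrite zR (poly2_eval_wide R3d) mulr_suml; apply/eqP; apply: eq_bigr => i _.
  by rewrite /a mulrAC.
have D0 : D == 0.
  by apply: contraT => D0; have := minQ D0 (leq_ltn_trans Dd dQ); rewrite evD eqxx.
move: (De i0); rewrite (eqP D0) coef0 => /esym /eqP; rewrite subr_eq0 => /eqP e.
rewrite ffunE -/(a i0) cpq apq; apply/eqP; rewrite eqr_div // -!rmorphM.
by apply/eqP; congr (ev1 _); rewrite e.
Qed.
End Minimal.

Lemma degree_bound : exists d, (d <= (size P).-1)%N /\ extension_degree rational_in d.
Proof.
have [Q [Q0 evQ QP minQ]] := exists_minimal_relation.
exists (size Q).-1; split; first by case: (size Q) (size P) QP => [|m] [|n].
exact: minimal_basis.
Qed.

End SimpleExtension.

(** * Widths of multiples and values of Laurent polynomials in the function field *)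

Section LeadingExponent.
Variables (l l' : 'cV[int]_2 -> int).
Hypothesis lD : forall m n, l (m + n) = l m + l n.
Hypothesis l'D : forall m n, l' (m + n) = l' m + l' n.
Hypothesis ll'_inj : forall m n, l m = l n -> l' m = l' n -> m = n.

(** A total order on exponents compatible with addition: the functional [l],
    refined by [l']. *)
Definition lex_le m n := l m < l n \/ (l m = l n /\ l' m <= l' n).

Lemma lex_max (s : seq 'cV[int]_2) : s != [::] ->
  exists2 m, m \in s & forall n, n \in s -> lex_le n m.
Proof.
elim: s => // a s IH _; have [->|/IH [m ms mmax]] := eqVneq s [::].
  by exists a; rewrite ?mem_head // => n; rewrite inE => /eqP ->; right.
have [am|ma] : lex_le a m \/ lex_le m a by rewrite /lex_le; lia.
  exists m; first by rewrite inE ms orbT.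
  by move=> n; rewrite inE => /orP[/eqP -> //|]; apply: mmax.
exists a; first exact: mem_head.
move=> n; rewrite inE => /orP[/eqP ->|/mmax]; first by right.
by move: ma; rewrite /lex_le; lia.
Qed.

Lemma msupp_nil (C : closedFieldType) (f : laurent C) : f != 0 -> (msupp f : seq _) != [::].
Proof.
by apply: contra_neq => f0; rewrite [f]monalgE f0 big_nil.
Qed.

(** The sum of the two greatest exponents is reached only once in the product, so
    its coefficient is a product of nonzero coefficients. *)
Lemma lead_exponentM (C : closedFieldType) (f h : laurent C) : f != 0 -> h != 0 ->
  exists m n, [/\ m \in msupp f, n \in msupp h, m + n \in msupp (f * h) &
    (forall k, k \in msupp f -> l k <= l m) /\ (forall k, k \in msupp h -> l k <= l n)].
Proof.
move=> /msupp_nil /lex_max [m mf mmax] /msupp_nil /lex_max [n nh nmax].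
exists m, n; split=> //; last by split=> k => [/mmax|/nmax]; rewrite /lex_le; lia.
rewrite -mcoeff_neq0 mcoeff_laurentM (big_fsetD1 m) //= (big_fsetD1 n) //= eqxx mulr1n.
rewrite [X in _ + X + _]big1_seq => [|k /= /fsetD1P [kn _]]; last first.
  by rewrite (inj_eq (addrI m)) (negbTE kn).
rewrite big1_seq => [|k /= /fsetD1P [km kf]]; last first.
  rewrite big1_seq // => k' /= k'h; case: eqP => // e; case/eqP: km.
  have := congr1 l e; have := congr1 l' e; rewrite !lD !l'D => e1 e2.
  have := mmax _ kf; have := nmax _ k'h; rewrite /lex_le => lek' lek.
  by apply: ll'_inj; lia.
by rewrite !addr0 mulf_neq0 ?mcoeff_neq0.
Qed.

End LeadingExponent.

(** [lead_exponentM] for the height and for its opposite: both the greatest and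
    the least heights add up in a product. *)
Lemma height_divides (C : closedFieldType) (f g : laurent C) m m' :
  divides f g -> g != 0 -> m \in msupp f -> m' \in msupp f ->
  exists n n', [/\ n \in msupp g, n' \in msupp g &
    m 1 0 - m' 1 0 <= n 1 0 - n' 1 0].
Proof.
move=> [h ->] fh0 mf m'f.
have f0 : f != 0 by apply: contra_neq fh0 => ->; rewrite mul0r.
have h0 : h != 0 by apply: contra_neq fh0 => ->; rewrite mulr0.
pose l (m : 'cV[int]_2) := m 1 0; pose l' (m : 'cV[int]_2) := m 0 0.
have lD (u v : 'cV[int]_2) : l (u + v) = l u + l v by rewrite /l !mxE.
have l'D (u v : 'cV[int]_2) : l' (u + v) = l' u + l' v by rewrite /l' !mxE.
have ND (k : 'cV[int]_2 -> int) : (forall u v, k (u + v) = k u + k v) ->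
    forall u v, - k (u + v) = - k u + - k v.
  by move=> kD u v; rewrite kD opprD.
have inj1 (u v : 'cV[int]_2) : l u = l v -> l' u = l' v -> u = v.
  by move=> e e'; apply: vec2_eqP.
have inj2 (u v : 'cV[int]_2) : - l u = - l v -> - l' u = - l' v -> u = v.
  by move=> /oppr_inj e /oppr_inj e'; apply: inj1.
have [a [b [af bh abfh [amax bmax]]]] := lead_exponentM lD l'D inj1 f0 h0.
have [c [d [cf dh cdfh [cmax dmax]]]] :=
  lead_exponentM (ND _ lD) (ND _ l'D) inj2 f0 h0.
exists (a + b), (c + d); split=> //.
have h1 : l m <= l a := amax _ mf.
have h2 : l c <= l m' by rewrite -lerN2; exact: cmax _ m'f.
have h3 : l d <= l b := bmax _ dh.
rewrite -![_ 1 0]/(l _) !lD.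
by move: (l m) (l a) (l c) (l m') (l d) (l b) h1 h2 h3; clear; lia.
Qed.

Lemma rmorph_monomial (C : closedFieldType) (K : fieldType)
    (phi : {rmorphism laurent C -> K}) m :
  phi (monomial C m) = phi (varx C) ^ (m 0 0) * phi (vary C) ^ (m 1 0).
Proof.
have nz n : phi (monomial C n) != 0.
  apply/eqP => e; have := congr1 phi (monomialK C n).
  by rewrite [X in X = _]rmorphM [X in _ = X]rmorph1 e mulr0 => /eqP; rewrite eq_sym oner_eq0.
have inv n : phi (monomial C (- n)) = (phi (monomial C n))^-1.
  apply: (mulIf (nz n)); rewrite -[LHS]rmorphM monomialK rmorph1 mulVf; [by []|exact: nz].
rewrite {1}(vec2_eta m); set a := m 0 0; set b := m 1 0.
have -> : vec2 a b = vec2 a 0 + vec2 0 b by rewrite vec2D addr0 add0r.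
rewrite monomialD rmorphM; congr (_ * _).
  case: (intP a) => [|k|k].
  - by rewrite expr0z -(rmorph1 phi) -monomial0; congr (phi (monomial _ _));
       apply: vec2_eqP; rewrite !mxE.
  - by rewrite -[RHS]rmorphXn varxX.
  - have -> : vec2 (- k.+1%:Z) 0 = - vec2 k.+1%:Z 0 by apply: vec2_eqP; rewrite !mxE ?oppr0.
    by rewrite inv -varxX rmorphXn exprnN.
case: (intP b) => [|k|k].
- by rewrite expr0z -(rmorph1 phi) -monomial0; congr (phi (monomial _ _));
     apply: vec2_eqP; rewrite !mxE.
- by rewrite -[RHS]rmorphXn varyX.
- have -> : vec2 0 (- k.+1%:Z) = - vec2 0 k.+1%:Z by apply: vec2_eqP; rewrite !mxE ?oppr0.
  by rewrite inv -varyX rmorphXn exprnN.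
Qed.

Section LaurentForms.
Variable C : closedFieldType.
Implicit Types (f g h : laurent C) (m k : 'cV[int]_2).

(** An explicit list of coefficients and exponents, in which an exponent may be
    repeated. *)
Definition laurent_form (r : seq (C * 'cV[int]_2)) : laurent C :=
  \sum_(p <- r) << p.1 *g p.2 >>.

(** The value of a [laurent_form] in a field; keeping [X] and [Y] abstract lets
    values be computed without unfolding Laurent polynomials. *)
Definition form_value (K : fieldType) (j : {rmorphism C -> K}) (X Y : K)
    (r : seq (C * 'cV[int]_2)) : K :=
  \sum_(p <- r) j p.1 * (X ^ (p.2 0 0) * Y ^ (p.2 1 0)).

Lemma laurent_formE g : g = laurent_form [seq (g@_m, m) | m <- msupp g].
Proof. by rewrite /laurent_form big_map [LHS]monalgE. Qed.

Lemma mcoeff_laurent_form r k :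
  (laurent_form r)@_k = \sum_(p <- r) p.1 *+ (p.2 == k).
Proof. by rewrite raddf_sum; apply: eq_bigr => p _; rewrite /= mcoeffU. Qed.

Lemma msupp_laurent_form r k :
  k \in msupp (laurent_form r) -> k \in [seq p.2 | p <- r].
Proof.
rewrite -mcoeff_neq0; apply: contraR => kr; rewrite mcoeff_laurent_form.
rewrite big_seq big1 // => p pr; case: eqP => // pk.
by case/negP: kr; rewrite -pk; apply: map_f.
Qed.

Lemma rmorph_laurent_form (K : fieldType) (phi : {rmorphism laurent C -> K}) r :
  phi (laurent_form r) =
  form_value (phi \o @laurentC C) (phi (varx C)) (phi (vary C)) r.
Proof.
rewrite /laurent_form [LHS]rmorph_sum; apply: eq_bigr => p _.
by rewrite termE [LHS]rmorphM [X in _ * X]rmorph_monomial.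
Qed.

Lemma generated_form_value (K : fieldType) (j : {rmorphism C -> K}) X Y t s r :
  generated j t s X -> generated j t s Y -> generated j t s (form_value j X Y r).
Proof.
move=> gX gY; apply: generated_sum => p _; apply: generatedM.
  exact: generated_const.
by apply: generatedM; apply: generated_expz.
Qed.

Lemma form_value_cons (K : fieldType) (j : {rmorphism C -> K}) X Y c a b r :
  form_value j X Y ((c, vec2 a b) :: r) = j c * (X ^ a * Y ^ b) + form_value j X Y r.
Proof. by rewrite /form_value big_cons /= !vec2K. Qed.

Lemma form_value_nil (K : fieldType) (j : {rmorphism C -> K}) X Y :
  form_value j X Y [::] = 0.
Proof. exact: big_nil. Qed.
End LaurentForms.

Section RationalMap.
Variable C : closedFieldType.

Lemma rational_map_bound (f : laurent C) (K : fieldType)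
    (phi : {rmorphism laurent C -> K}) t s (P : {poly {poly C}}) :
  is_function_field f phi -> ~ constants phi t ->
  P != 0 -> poly2_eval (phi \o @laurentC C) t s P = 0 ->
  generated (phi \o @laurentC C) t s (phi (varx C)) ->
  generated (phi \o @laurentC C) t s (phi (vary C)) ->
  exists d, (d <= (size P).-1)%N /\ has_rational_map_of_degree f d.
Proof.
move=> ff tC P0 evP genx geny.
have t_trans p : p != 0 -> poly_eval (phi \o @laurentC C) t p != 0.
  by apply: nonconstant_transcendental => c tc; apply: tC; exists c.
have [_ frac] := ff.
have gen_phi g : generated (phi \o @laurentC C) t s (phi g).
  by rewrite (laurent_formE g) rmorph_laurent_form; apply: generated_form_value.
have gen z : generated (phi \o @laurentC C) t s z.
  have [g [h [_ ->]]] := frac z.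
  by apply: generatedM; [exact: gen_phi|exact: generatedV (gen_phi h)].
have [d [dP dE]] := degree_bound t_trans P0 evP gen.
by exists d; split=> //; exists K, phi, t.
Qed.
End RationalMap.

(** * Newton polygons in a strip *)

Section Strip.
Variables (C : closedFieldType) (f : laurent C).
Hypothesis irrf : irreducible_elt f.

(** The tool that shows functions to be nonzero, hence maps to be nonconstant: a
    multiple of [f] cannot be narrower than [f]. *)
Lemma height_not_zero (K : fieldType) (phi : {rmorphism laurent C -> K}) g m m' b w :
  is_function_field f phi ->
  m \in msupp f -> m' \in msupp f -> w < m 1 0 - m' 1 0 ->
  (forall k : 'cV[int]_2, k \in msupp g -> b <= k 1 0 <= b + w) ->
  phi g = 0 -> g = 0.
Proof.
move=> /(function_fieldP irrf) [phi0 _] mf m'f wm gw /phi0 fg.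
apply/eqP; apply: contraT => g0.
have [n [n' [/gw /andP[_ nb] /gw /andP[bn' _] mn]]] := height_divides fg g0 mf m'f.
have: w < w; last by rewrite ltxx.
apply: lt_le_trans wm (le_trans mn _); rewrite lerBlDr.
by apply: le_trans nb _; rewrite addrC lerD2l.
Qed.

(** The rational map is x.  A horizontal shift makes [f] a polynomial of degree at
    most [s] in y, and the two heights forbid x - c to vanish on the curve. *)
Lemma strip_bound (s : nat) m m' :
  (forall k : 'cV[int]_2, k \in msupp f -> 0 <= k 1 0 <= s%:Z) ->
  m \in msupp f -> m' \in msupp f -> m' 1 0 < m 1 0 ->
  exists d, (d <= s)%N /\ has_rational_map_of_degree f d.
Proof.
move=> fs mf m'f m'm; have [K [phi ff]] := function_field_exists irrf.
have [n fn] := nonneg_shift f.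
pose b : 'cV[int]_2 := vec2 n%:Z 0; pose g := monomial C b * f.
have g0 : nonneg_supp g.
  move=> k; rewrite msupp_monomialM => kg; split.
    have /fn [] : k + vec2 0 n%:Z \in msupp (monomial C (vec2 n%:Z n%:Z) * f).
      rewrite msupp_monomialM (_ : _ - _ = k - b) //.
      by apply: vec2_eqP; rewrite !mxE /=; lia.
    by rewrite !mxE /= addr0.
  by move: (fs _ kg); rewrite !mxE /= subr0 => /andP[].
pose P := to_poly2 g.
have Ps : (size P <= s.+1)%N.
  apply/leq_sizeP => k sk; apply/polyP => i; rewrite coef0 coef_to_poly2 //.
  rewrite mcoeff_monomialM; apply/mcoeff_outdom/negP => /fs.
  by rewrite !mxE /= subr0; lia.
have P0 : P != 0.
  rewrite to_poly2_eq0 //; apply/eqP => /(invertible_mul_eq0 (monomial_unit C b)).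
  by case: irrf.
have evP : poly2_eval (phi \o @laurentC C) (phi (varx C)) (phi (vary C)) P = 0.
  rewrite -rmorph_poly2_eval -[poly2_eval _ _ _ P]/(of_poly2 P) to_poly2K //.
  apply: (((function_fieldP irrf phi).1 ff).1 _).2.
  by exists (monomial C b); rewrite mulrC.
have tC : ~ constants phi (phi (varx C)).
  move=> [c _ e].
  pose v := laurent_form [:: (1, vec2 1 0); (- c, vec2 0 0)].
  have v0 : v = 0.
    apply: (@height_not_zero _ phi v m m' 0 0 ff mf m'f); first by rewrite subr_gt0.
      by move=> k /msupp_laurent_form; rewrite !inE => /orP[] /eqP ->; rewrite !vec2K.
    rewrite rmorph_laurent_form !form_value_cons form_value_nil rmorph1 rmorphN.
    rewrite expr1z !expr0z !mulr1 mul1r addr0 /=.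
    by apply/eqP; rewrite subr_eq0; apply/eqP; exact: esym e.
  have := congr1 (mcoeff (vec2 1 0)) v0; rewrite mcoeff_laurent_form !big_cons big_nil.
  rewrite mcoeff0 /= eqxx addr0; case: eqP => [/(congr1 (fun u : 'cV__ => u 0 0))|_].
    by rewrite !vec2K.
  by rewrite addr0 => /eqP; rewrite oner_eq0.
have [d [dP hd]] := rational_map_bound ff tC P0 evP (generated_fst _ _ _) (generated_snd _ _ _).
exists d; split; last exact: hd.
by apply: leq_trans dP _; case: (size P) Ps.
Qed.
End Strip.

(** * Multiples of the standard simplex: projection from a point at infinity *)

Section Shear.
Variable C : closedFieldType.

Lemma coef_linear_pow (A : comNzRingType) (a b : A) k n : (k <= n)%N ->
  ((a%:P + b%:P * 'X) ^+ k)`_n = if n == k then b ^+ k else 0.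
Proof.
elim: k n => [|k IH] n kn; first by rewrite !expr0 coef1; case: (n == 0%N).
case: n kn => // n kn; rewrite exprS mulrDl coefD coefCM -mulrA coefCM coefXM /=.
rewrite !IH //; last exact: leqW.
rewrite eqSS gtn_eqF ?mulr0 ?add0r ?ltnS //.
by case: eqP; rewrite ?mulr0 // exprS.
Qed.

(** The substitution y := T + c x, where x stays the outer variable and T is the
    inner one. *)
Definition shear (c : C) : {poly {poly C}} -> {poly {poly C}} :=
  poly2_eval (@polyCC C) 'X ('X%:P + c%:P%:P * 'X).
HB.instance Definition _ c := GRing.RMorphism.copy (shear c)
  (poly2_eval (@polyCC C) 'X ('X%:P + c%:P%:P * 'X)).

Lemma shear_term (c a : C) i k :
  shear c ((a *: 'X^i)%:P * 'X^k) =
  a%:P%:P * ('X^i * ('X%:P + c%:P%:P * 'X) ^+ k).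
Proof.
rewrite rmorphM /= /shear poly2_evalC rmorphXn /= poly2_evalX -mul_polyC.
by rewrite rmorphM /= poly_evalC rmorphXn /= poly_evalX mulrA.
Qed.

(** The substitution is invertible: (b - c a, a) are the new coordinates of the
    point (a, b). *)
Lemma shear_neq0 c P : P != 0 -> shear c P != 0.
Proof.
move=> /poly2_nonroot [a [b [_ _]]]; apply: contraNneq => P0.
have := poly2_eval_comp (idfun : {rmorphism C -> C}) (b - c * a) a 'X
  ('X%:P + c%:P%:P * 'X) P.
rewrite -[poly2_eval (@polyCC C) _ _ P]/(shear c P) P0 rmorph0 poly2_evalX.
rewrite rmorphD rmorphM /= !poly2_evalC !poly2_evalX /= poly_evalX poly_evalC /=.
by rewrite subrK /poly2_at => <-.
Qed.
End Shear.

Section Simplex.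
Variables (C : closedFieldType) (f : laurent C) (d : nat).
Hypothesis irrf : irreducible_elt f.
Hypothesis d2 : (2 <= d)%N.
Hypothesis f_pos : nonneg_supp f.
Hypothesis f_deg : forall m : 'cV[int]_2, m \in msupp f -> m 0 0 + m 1 0 <= d%:Z.
Hypothesis f_0d : vec2 0 d%:Z \in msupp f.
Hypothesis f_00 : vec2 0 0 \in msupp f.

(** The top homogeneous form of [f], dehomogenized at x = 1: its roots are the
    points at infinity of the curve. *)
Definition edge_poly : {poly C} :=
  \sum_(m <- msupp f | m 0 0 + m 1 0 == d%:Z) f@_m *: 'X^`|m 1 0|.

Lemma edge_poly_root : exists c, root edge_poly c.
Proof.
apply/closed_rootP; rewrite neq_ltn; apply/orP; right.
apply: leq_trans (_ : d.+1 <= _)%N; first by rewrite ltnS ltnW.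
rewrite ltnNge; apply/negP => /leq_sizeP /(_ d (leqnn d)).
rewrite /edge_poly big_mkcond coef_sum (big_fsetD1 _ f_0d) /= !vec2K add0r eqxx.
rewrite coefZ coefXn eqxx mulr1 big1_seq ?addr0 => [/eqP|m /andP[_]].
  by rewrite mcoeff_eq0 f_0d.
move=> /fsetD1P [mne mf]; case: eqP => md; last by rewrite coef0.
rewrite coefZ coefXn; have [e|] := eqVneq; last by rewrite mulr0.
case/eqP: mne; have [m0 m1] := f_pos mf.
by apply: vec2Z_eqP; rewrite !vec2K;
  move: (e : d = _ :> nat) (md : _ = _ :> int) m0 m1; clear; lia.
Qed.

(** The coefficient of degree [d] in x is the value of [edge_poly] at [c]. *)
Lemma size_shear c : root edge_poly c -> (size (shear c (to_poly2 f)) <= d)%N.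
Proof.
move=> rc; apply/leq_sizeP => n dn.
rewrite /to_poly2 raddf_sum coef_sum.
have E m : m \in msupp f ->
    (shear c ((f@_m *: 'X^`|m 0 0|)%:P * 'X^`|m 1 0|))`_n =
    (if (m 0 0 + m 1 0 == d%:Z) && (n == d) then f@_m * c ^+ `|m 1 0| else 0)%:P.
  move=> mf; have [m0 m1] := f_pos mf; have md := f_deg mf.
  move: md (gez0_abs m0) (gez0_abs m1).
  set i := absz (m 0 0); set k := absz (m 1 0) => md i0 k0.
  rewrite -i0 -k0 in md *; rewrite shear_term coefCM coefXnM.
  have -> : (n < i)%N = false by move: md dn; clear; lia.
  rewrite coef_linear_pow; last by move: md dn; clear; lia.
  have -> : (n - i == k)%N = (i%:Z + k%:Z == d%:Z) && (n == d).
    by move: md dn; clear; lia.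
  by case: ifP; rewrite ?mulr0 ?polyC0 // -polyC_exp -polyCM.
rewrite big_seq (eq_bigr _ E) -big_seq -(raddf_sum (@polyC C)) /=.
apply/eqP; rewrite polyC_eq0; case: (n == d); last by rewrite big1 // => m _; rewrite andbF.
move: rc; rewrite /edge_poly rootE horner_sum big_mkcond /= => /eqP rc.
rewrite -[X in _ == X]rc; apply/eqP; apply: eq_bigr => m _; rewrite andbT.
by case: ifP => // _; rewrite hornerZ hornerXn.
Qed.

(** Take t = y - c x and s = x, with (1 : c) a point at infinity of the curve. *)
Lemma simplex_bound : exists e, (e <= d - 1)%N /\ has_rational_map_of_degree f e.
Proof.
have [K [phi ff]] := function_field_exists irrf.
have [c rc] := edge_poly_root.
pose P := shear c (to_poly2 f).
pose j := phi \o @laurentC C; pose X := phi (varx C); pose Y := phi (vary C).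
have P0 : P != 0 by apply: shear_neq0; rewrite to_poly2_eq0 //; apply/eqP; case: irrf.
have E : poly2_eval j (Y - j c * X) X ('X%:P + c%:P%:P * 'X) = Y.
  rewrite rmorphD rmorphM /= !poly2_evalC poly2_evalX /= poly_evalX poly_evalC.
  by rewrite subrK.
have evP : poly2_eval j (Y - j c * X) X P = 0.
  rewrite /P /shear poly2_eval_comp E poly2_evalX -rmorph_poly2_eval.
  rewrite -[poly2_eval _ _ _ _]/(of_poly2 (to_poly2 f)) to_poly2K //.
  apply: (((function_fieldP irrf phi).1 ff).1 _).2.
  by exists 1; rewrite mulr1.
have tC : ~ constants phi (Y - j c * X).
  move=> [c0 _ e].
  have val (L : fieldType) (i : {rmorphism C -> L}) x y :
      form_value i x y [:: (1, vec2 0 1); (- c, vec2 1 0); (- c0, vec2 0 0)]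
      = y - i c * x - i c0.
    rewrite !form_value_cons form_value_nil rmorph1 !rmorphN !expr1z !expr0z; ring.
  pose v := laurent_form [:: (1, vec2 0 1); (- c, vec2 1 0); (- c0, vec2 0 0)].
  have v0 : v = 0.
    apply: (@height_not_zero _ f irrf _ phi v _ _ 0 1 ff f_0d f_00).
    - by rewrite !vec2K; lia.
    - by move=> k /msupp_laurent_form; rewrite !inE => /or3P[] /eqP ->; rewrite !vec2K.
    rewrite rmorph_laurent_form val; apply/eqP; rewrite subr_eq0; apply/eqP.
    exact: esym e.
  have := congr1 (mcoeff (vec2 0 1)) v0; rewrite mcoeff_laurent_form !big_cons big_nil.
  rewrite mcoeff0 /= eqxx; case: eqP => [/(congr1 (fun u : 'cV__ => u 0 0))|_].
    by rewrite !vec2K.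
  case: eqP => [/(congr1 (fun u : 'cV__ => u 1 0))|_]; first by rewrite !vec2K.
  by rewrite !addr0 => /eqP; rewrite oner_eq0.
have genY : generated j (Y - j c * X) X Y.
  rewrite -[in X in generated _ _ _ X]E; exact: generated_eval.
have [e [eP he]] := rational_map_bound ff tC P0 evP (generated_snd _ _ _) genY.
exists e; split; last exact: he.
rewrite subn1; apply: leq_trans eP _.
by have := size_shear rc; rewrite -/P; case: (size P) d => [|p] [|q].
Qed.

End Simplex.

(** * Lines of a ruled quadric against the cubic surface *)

Section LineCubic.
Variables (C : closedFieldType) (K : fieldType) (j : {rmorphism C -> K}) (t : K).
Hypothesis t_trans : forall p, p != 0 -> poly_eval j t p != 0.
Local Notation ev1 := (poly_eval j t).

(** [s] generates the subfield of [x] and [y] over C(t), and has degree at most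
    [n] over C(t). *)
Definition low_degree_generator n (s x y : K) := exists P : {poly {poly C}},
  [/\ P != 0, (size P <= n.+1)%N & poly2_eval j t s P = 0] /\
  (generated j t s x /\ generated j t s y).

Lemma size_linear (A : nzRingType) (u v : A) : (size (u%:P * 'X + v%:P)%R <= 2)%N.
Proof.
apply: (leq_trans (size_polyD _ _)); rewrite geq_max.
rewrite (leq_trans (size_polyMleq _ _)) ?size_polyX ?addn2 /= ?ltnS ?size_polyC_leq1 //.
exact: leqW (size_polyC_leq1 _).
Qed.

(** The first equation is z x y = 1 with z eliminated by a linear equation.  The
    second one expresses y in x, which gives a cubic equation for x; its constant
    term is b ^ 2, hence it is not trivial. *)
Lemma line_cubic (al be ga a b c : {poly C}) x y :
  1 + (ev1 al * x + ev1 be * y + ev1 ga) * (x * y) = 0 ->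
  ev1 a * x + ev1 b * y + ev1 c = 0 -> b != 0 ->
  low_degree_generator 3 x x y.
Proof.
move=> cub lin b0; have eb0 := t_trans b0.
have yE : y = - (ev1 a * x + ev1 c) / ev1 b.
  by apply: (mulIf eb0); rewrite mulfVK //; apply/eqP; rewrite -addr_eq0 -lin; apply/eqP; ring.
pose lf (u v : {poly C}) : {poly {poly C}} := u%:P * 'X + v%:P.
have evlf u v : poly2_eval j t x (lf u v) = ev1 u * x + ev1 v.
  by rewrite rmorphD rmorphM /= !poly2_evalC poly2_evalX.
(* The equation 1 + (al x + be y + ga) x y = 0 times b ^ 2, where b y = - (a x + c),
   is N x + b ^ 2 = 0. *)
pose N := lf a c * lf (be * a - al * b) (be * c - ga * b).
exists (N * 'X + (b ^+ 2)%:P); split; [split|split].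
- apply/eqP => /(congr1 (fun p : {poly {poly C}} => p`_0)).
  rewrite coefD coefC coefMX /= add0r coef0 => /eqP.
  by rewrite expf_eq0 (negbTE b0).
- apply: (leq_trans (size_polyD _ _)); rewrite geq_max.
  rewrite (leq_trans (size_polyC_leq1 _)) // andbT.
  apply: (leq_trans (size_polyMleq _ _)); rewrite size_polyX addn2 /= ltnS.
  apply: (leq_trans (size_polyMleq _ _)).
  have := size_linear a c; have := size_linear (be * a - al * b) (be * c - ga * b).
  by rewrite -!/(lf _ _); case: (size (lf a c)) (size (lf _ _)) => [|[|[|?]]] [|[|[|?]]].
- have evN : poly2_eval j t x N = (ev1 a * x + ev1 c) *
      ((ev1 be * ev1 a - ev1 al * ev1 b) * x + (ev1 be * ev1 c - ev1 ga * ev1 b)).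
    by rewrite rmorphM /= !evlf !rmorphB !rmorphM.
  have evNX : poly2_eval j t x (N * 'X) = poly2_eval j t x N * x.
    by rewrite (rmorphM (poly2_eval j t x) N 'X) /= poly2_evalX.
  rewrite rmorphD /= evNX poly2_evalC evN (rmorphXn ev1) /=.
  have := cub; rewrite yE => {}cub.
  rewrite -[RHS](mulr0 (ev1 b ^+ 2)) -cub; field; exact: eb0.
- exact: generated_snd.
- rewrite yE; apply: generatedM; last first.
    by apply: generatedV; rewrite -(poly2_evalC j t x); apply: generated_eval.
  have := generated_eval j t x (lf (- a) (- c)).
  by rewrite evlf !rmorphN mulNr -opprD.
Qed.

(** On the line l1 = t l3, l4 = t l2, the first equation gives w in terms of x and
    y, and eliminating w between the two leaves a linear equation in x and y
    with coefficients in C[t].  If the latter were trivial, its coefficients of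
    degree 2 in t, which are those of l3 up to the factor - q0, would vanish. *)
Lemma quadric_line (q0 a1 a2 a3 b1 b2 b3 c1 c2 c3 d1 d2 d3 : C) w x y l1 l2 l3 l4 :
  w * (x * y) = 1 ->
  l1 = w + j a1 * x + j a2 * y + j a3 ->
  l2 = j q0 * w + j b1 * x + j b2 * y + j b3 ->
  l3 = j c1 * x + j c2 * y + j c3 ->
  l4 = j d1 * x + j d2 * y + j d3 ->
  l1 * l2 = l3 * l4 -> l3 != 0 -> t = l1 / l3 -> q0 != 0 ->
  low_degree_generator 3 x x y \/ low_degree_generator 3 y x y.
Proof.
move=> wxy l1E l2E l3E l4E quad l30 tE q00.
have l1t : l1 = t * l3 by rewrite tE mulfVK.
have l4t : l4 = t * l2 by apply: (mulfI l30); rewrite -quad l1t; ring.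
pose al := a1%:P - c1%:P * 'X; pose be := a2%:P - c2%:P * 'X; pose ga := a3%:P - c3%:P * 'X.
have linE u v : ev1 (u%:P - v%:P * 'X) = j u - j v * t.
  by rewrite rmorphB rmorphM /= !poly_evalC poly_evalX.
(* The coefficients of l4 - t l2 + t q0 (l1 - t l3), in which w cancels. *)
pose co d b a c : {poly C} := d%:P - b%:P * 'X + (q0 * a)%:P * 'X - (q0 * c)%:P * 'X^2.
have coE d b a c : ev1 (co d b a c) = j d - t * j b + t * j q0 * j a - t ^+ 2 * j q0 * j c.
  rewrite /co rmorphB rmorphD rmorphB !rmorphM /= !poly_evalC !poly_evalX.
  by ring.
have cub : 1 + (ev1 al * x + ev1 be * y + ev1 ga) * (x * y) = 0.
  rewrite !linE -wxy -mulrDl (_ : w + _ = l1 - t * l3); last by rewrite l1E l3E; ring.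
  by rewrite l1t subrr mul0r.
have lin : ev1 (co d1 b1 a1 c1) * x + ev1 (co d2 b2 a2 c2) * y + ev1 (co d3 b3 a3 c3) = 0.
  rewrite !coE; have: l4 - t * l2 + t * j q0 * (l1 - t * l3) = 0.
    by rewrite l4t l1t !subrr mulr0 addr0.
  rewrite l1E l2E l3E l4E => <-; ring.
have [b0|b0] := eqVneq (co d2 b2 a2 c2) 0; last by left; apply: line_cubic cub lin b0.
have [a0|a0] := eqVneq (co d1 b1 a1 c1) 0; last first.
  right; have [||P [? [? ?]]] := @line_cubic be al ga (co d2 b2 a2 c2) (co d1 b1 a1 c1)
    (co d3 b3 a3 c3) y x _ _ a0.
  - by rewrite -cub; ring.
  - by rewrite -lin; ring.
  by exists P.
have c0 : co d3 b3 a3 c3 = 0.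
  apply/eqP; apply: contraT => /t_trans; move: lin; rewrite a0 b0 rmorph0 !mul0r !add0r.
  by move=> ->; rewrite eqxx.
have top d b a c : co d b a c = 0 -> c = 0.
  move=> /(congr1 (fun p : {poly C} => p`_2)); rewrite !(coefB, coefD, coefCM, coefX, coefXn, coefC) /=.
  by rewrite !mulr0 mulr1 !subr0 add0r sub0r => /eqP; rewrite oppr_eq0 mulf_eq0 (negbTE q00) => /eqP.
case/eqP: l30; rewrite l3E (top _ _ _ _ a0) (top _ _ _ _ b0) (top _ _ _ _ c0) !rmorph0.
by rewrite !mul0r !addr0.
Qed.
End LineCubic.

(** * Splitting quaternary quadratic forms *)

Section QuadraticForms.
Variable C : closedFieldType.
Hypothesis two_neq0 : (2%:R : C) != 0.

Lemma closed_sqrt (a : C) : exists r, r ^+ 2 = a.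
Proof.
have /closed_rootP [r] : size ('X^2 - a%:P) != 1%N by rewrite size_XnsubC.
by rewrite rootE !hornerE subr_eq0 => /eqP; exists r.
Qed.

(** A root of the dehomogenized form gives a linear factor. *)
Lemma binary_form_split (A B D : C) : exists c2 c3 d2 d3,
  [/\ A = - (c2 * d2), B = - (c2 * d3 + c3 * d2) & D = - (c3 * d3)].
Proof.
have [->|A0] := eqVneq A 0.
  by exists 0, 1, (- B), (- D); split; ring.
have /closed_rootP [r] : size (A *: 'X^2 + (B *: 'X + D%:P)) != 1%N.
  rewrite size_polyDl ?size_scale ?size_polyXn //.
  apply: leq_ltn_trans (size_polyD _ _) _; rewrite gtn_max.
  rewrite (leq_ltn_trans (size_scale_leq _ _)) ?size_polyX //.
  by rewrite (leq_ltn_trans (size_polyC_leq1 _)).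
rewrite rootE !hornerD !hornerZ hornerXn hornerX hornerC => /eqP e0.
have e : A * r ^+ 2 + (B * r + D) = 0 := e0.
exists 1, (- r), (- A), (- (A * r + B)); split; try ring.
by apply/eqP; rewrite -subr_eq0 -e; apply/eqP; ring.
Qed.

(** Completing the square with respect to the first variable leaves a binary
    form.  If the first square is absent, the form is completed instead around
    a linear factor of the terms that contain the first variable. *)
Lemma ternary_form_split (k A B D E F G : C) : k != 0 ->
  exists n1 n2 n3 c1 c2 c3 d1 d2 d3,
  [/\ A = k * n1 ^+ 2 - c1 * d1, B = 2%:R * k * n1 * n2 - (c1 * d2 + c2 * d1),
      D = k * n2 ^+ 2 - c2 * d2 &
      [/\ E = 2%:R * k * n1 * n3 - (c1 * d3 + c3 * d1),
          F = 2%:R * k * n2 * n3 - (c2 * d3 + c3 * d2) &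
          G = k * n3 ^+ 2 - c3 * d3]].
Proof.
move=> k0; have [A0|A0] := eqVneq A 0; last first.
  have [n nA] := closed_sqrt (A / k).
  have n0 : n != 0.
    by apply: contra_neq A0 => n0; apply/eqP; move/esym/eqP: nA;
       rewrite n0 expr0n /= mulf_eq0 invr_eq0 (negbTE k0) orbF.
  have AE : A = k * n ^+ 2 by rewrite nA mulrC mulfVK.
  pose n2 := B / (2%:R * k * n); pose n3 := E / (2%:R * k * n).
  have [c2 [c3 [d2 [d3 [e1 e2 e3]]]]] :=
    binary_form_split (D - k * n2 ^+ 2) (F - 2%:R * k * n2 * n3) (G - k * n3 ^+ 2).
  exists n, n2, n3, 0, c2, c3, 0, d2, d3; split; [..|split].
  - by rewrite AE; ring.
  - by rewrite /n2; field; rewrite k0 n0 two_neq0.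
  - by rewrite -(subrK (k * n2 ^+ 2) D) e1; ring.
  - by rewrite /n3; field; rewrite k0 n0 two_neq0.
  - by rewrite -(subrK (2%:R * k * n2 * n3) F) e2; ring.
  - by rewrite -(subrK (k * n3 ^+ 2) G) e3; ring.
have [B0|B0] := eqVneq B 0; last first.
  (* The terms containing the first variable are its product with the linear form
     (B, E) of the other two; division by that form leaves a multiple of a
     square. *)
  pose d2 := D / B; pose d3 := (F - E * d2) / B.
  have [n3 nE] := closed_sqrt ((G - E * d3) / k).
  exists 0, 0, n3, 0, (- B), (- E), 1, d2, d3; rewrite A0 nE; split; [..|split]; try ring.
  - by rewrite /d2; field.
  - by rewrite /d3; field.
  - by field.
have [E0|E0] := eqVneq E 0; last first.
  have [n2 nE] := closed_sqrt (D / k).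
  exists 0, n2, 0, 0, 0, (- E), 1, (F / E), (G / E); rewrite A0 B0 nE.
  by split; [..|split]; try ring; field; rewrite ?E0.
have [c2 [c3 [d2 [d3 [-> -> ->]]]]] := binary_form_split D F G.
by exists 0, 0, 0, 0, c2, c3, 0, d2, d3; rewrite A0 B0 E0; split; [..|split]; ring.
Qed.

(** Completing the square with respect to z0 leaves a ternary form.  Split it as
    - q00 n ^ 2 - l3 l4, so that q00 (z0 + h) ^ 2 - q00 n ^ 2 is the product
    l1 l2.  In this way z0 occurs in l1 and l2 only. *)
Lemma quadric_split (q00 q01 q02 q03 q11 q12 q13 q22 q23 q33 : C) : q00 != 0 ->
  exists a1 a2 a3 b1 b2 b3 c1 c2 c3 d1 d2 d3,
  [/\ [/\ q01 = b1 + q00 * a1, q02 = b2 + q00 * a2 & q03 = b3 + q00 * a3],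
      [/\ q11 = a1 * b1 - c1 * d1, q12 = a1 * b2 + a2 * b1 - (c1 * d2 + c2 * d1) &
          q22 = a2 * b2 - c2 * d2] &
      [/\ q13 = a1 * b3 + a3 * b1 - (c1 * d3 + c3 * d1),
          q23 = a2 * b3 + a3 * b2 - (c2 * d3 + c3 * d2) &
          q33 = a3 * b3 - c3 * d3]].
Proof.
move=> q0.
pose h1 := q01 / (2%:R * q00); pose h2 := q02 / (2%:R * q00); pose h3 := q03 / (2%:R * q00).
have Nq0 : - q00 != 0 by rewrite oppr_eq0.
have [n1 [n2 [n3 [c1 [c2 [c3 [d1 [d2 [d3 [e1 e2 e3 [e4 e5 e6]]]]]]]]]]] :=
  ternary_form_split (q11 - q00 * h1 ^+ 2) (q12 - 2%:R * q00 * h1 * h2)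
    (q22 - q00 * h2 ^+ 2) (q13 - 2%:R * q00 * h1 * h3) (q23 - 2%:R * q00 * h2 * h3)
    (q33 - q00 * h3 ^+ 2) Nq0.
exists (h1 + n1), (h2 + n2), (h3 + n3), (q00 * (h1 - n1)), (q00 * (h2 - n2)), (q00 * (h3 - n3)).
exists c1, c2, c3, d1, d2, d3; split; split.
- by rewrite /h1; field; rewrite q0 two_neq0.
- by rewrite /h2; field; rewrite q0 two_neq0.
- by rewrite /h3; field; rewrite q0 two_neq0.
- by rewrite -(subrK (q00 * h1 ^+ 2) q11) e1; ring.
- by rewrite -(subrK (2%:R * q00 * h1 * h2) q12) e2; ring.
- by rewrite -(subrK (q00 * h2 ^+ 2) q22) e3; ring.
- by rewrite -(subrK (2%:R * q00 * h1 * h3) q13) e4; ring.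
- by rewrite -(subrK (2%:R * q00 * h2 * h3) q23) e5; ring.
- by rewrite -(subrK (q00 * h3 ^+ 2) q33) e6; ring.
Qed.

End QuadraticForms.

(** The general quadratic form in z0, z1, z2 and 1. *)
Definition quadric (A : comNzRingType) (q00 q01 q02 q03 q11 q12 q13 q22 q23 q33 z0 z1 z2 : A) :=
  q00 * (z0 * z0) + q01 * (z0 * z1) + q02 * (z0 * z2) + q03 * z0 +
  q11 * (z1 * z1) + q12 * (z1 * z2) + q13 * z1 + q22 * (z2 * z2) + q23 * z2 + q33.

Lemma quadric_identity (C A : comNzRingType) (j : {rmorphism C -> A})
    (q00 a1 a2 a3 b1 b2 b3 c1 c2 c3 d1 d2 d3 : C) (z0 z1 z2 : A) :
  quadric (j q00) (j (b1 + q00 * a1)) (j (b2 + q00 * a2)) (j (b3 + q00 * a3))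
    (j (a1 * b1 - c1 * d1)) (j (a1 * b2 + a2 * b1 - (c1 * d2 + c2 * d1)))
    (j (a1 * b3 + a3 * b1 - (c1 * d3 + c3 * d1))) (j (a2 * b2 - c2 * d2))
    (j (a2 * b3 + a3 * b2 - (c2 * d3 + c3 * d2))) (j (a3 * b3 - c3 * d3)) z0 z1 z2
  = (j 1 * z0 + (j a1 * z1 + (j a2 * z2 + j a3))) *
      (j q00 * z0 + (j b1 * z1 + (j b2 * z2 + j b3)))
    - (j 0 * z0 + (j c1 * z1 + (j c2 * z2 + j c3))) *
      (j 0 * z0 + (j d1 * z1 + (j d2 * z2 + j d3))).
Proof. by rewrite /quadric !(rmorphD, rmorphB, rmorphM, rmorph1, rmorph0); ring. Qed.

(** * The polygon 2 Upsilon: rulings of the quadric containing the canonical curve *)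

(** The lattice points of 2 Upsilon, in the order of the coefficients of
    [quadric], as sums of two of (-1, -1), (1, 0), (0, 1) and (0, 0). *)
Definition upsilon2_points : seq (int * int) :=
  [:: (-2, -2); (0, -1); (-1, 0); (-1, -1); (2, 0); (1, 1); (1, 0); (0, 2); (0, 1); (0, 0)].

Lemma vec2_inj : injective (fun p : int * int => vec2 p.1 p.2).
Proof.
move=> [a b] [c d] e; have := congr1 (fun u : 'cV__ => u 0 0) e.
by have := congr1 (fun u : 'cV__ => u 1 0) e; rewrite /= !vec2K => -> ->.
Qed.

Lemma mem_upsilon2 (a b : int) : a + b <= 2 -> a - 2 * b <= 2 -> b - 2 * a <= 2 ->
  (a, b) \in upsilon2_points.
Proof.
move=> h1 h2 h3.
have a_range : a = -2 \/ a = -1 \/ a = 0 \/ a = 1 \/ a = 2 by lia.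
have b_range : b = -2 \/ b = -1 \/ b = 0 \/ b = 1 \/ b = 2 by lia.
by case: a_range h1 h2 h3 => [|[|[|[|]]]] ->; case: b_range => [|[|[|[|]]]] ->.
Qed.

Lemma quadric_of_products (A : comNzRingType)
    (q00 q01 q02 q03 q11 q12 q13 q22 q23 q33 z0 z1 z2 m00 m01 m02 m11 m12 m22 : A) :
  z0 * z0 = m00 -> z0 * z1 = m01 -> z0 * z2 = m02 ->
  z1 * z1 = m11 -> z1 * z2 = m12 -> z2 * z2 = m22 ->
  q00 * m00 + (q01 * m01 + (q02 * m02 + (q03 * z0 + (q11 * m11 + (q12 * m12 +
    (q13 * z1 + (q22 * m22 + (q23 * z2 + (q33 * 1 + 0))))))))) =
  quadric q00 q01 q02 q03 q11 q12 q13 q22 q23 q33 z0 z1 z2.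
Proof. by move=> <- <- <- <- <- <-; rewrite /quadric; ring. Qed.

Section Upsilon.
Variable C : closedFieldType.
Hypothesis two_neq0 : (2%:R : C) != 0.

Lemma laurent_form_of_supp (g : laurent C) (r : seq 'cV[int]_2) : uniq r ->
  {subset msupp g <= r} -> g = laurent_form [seq (g@_m, m) | m <- r].
Proof.
move=> ur gr; apply/malgP => k; rewrite mcoeff_laurent_form big_map /=.
have [kr|kr] := boolP (k \in r).
  by rewrite (bigD1_seq k) //= eqxx big1 ?addr0 // => m /negbTE ->.
rewrite mcoeff_outdom; last by apply: contra kr; apply: gr.
by rewrite big_seq big1 // => m mr; case: eqP kr => // <-; rewrite mr.
Qed.

Lemma laurent_form_cons (c : C) m r :
  laurent_form ((c, m) :: r) = laurentC c * monomial C m + laurent_form r.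
Proof. by rewrite /laurent_form big_cons termE. Qed.

Lemma laurent_form_nil : laurent_form [::] = 0 :> laurent C.
Proof. exact: big_nil. Qed.

Lemma monomial00 : monomial C (vec2 0 0) = 1.
Proof. by rewrite -monomial0; congr monomial; apply: vec2Z_eqP; rewrite !mxE. Qed.

(** A Laurent polynomial supported on the lattice points of Upsilon. *)
Definition linear_form (q a b c : C) : laurent C :=
  laurent_form [:: (q, vec2 (-1) (-1)); (a, vec2 1 0); (b, vec2 0 1); (c, vec2 0 0)].

Let z0 := monomial C (vec2 (-1) (-1)).
Let z1 := monomial C (vec2 1 0).
Let z2 := monomial C (vec2 0 1).

Lemma linear_formE q a b c : linear_form q a b c =
  laurentC q * z0 + (laurentC a * z1 + (laurentC b * z2 + laurentC c)).
Proof.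
have sum4 (V : zmodType) (t1 t2 t3 t4 : V) :
    t1 + (t2 + (t3 + (t4 + 0))) = t1 + (t2 + (t3 + t4)) by rewrite addr0.
rewrite /linear_form !laurent_form_cons laurent_form_nil [LHS]sum4.
by rewrite monomial00 [X in _ + (_ + (_ + X)) = _]mulr1.
Qed.

Lemma linear_form_height q a b c (k : 'cV[int]_2) :
  k \in msupp (linear_form q a b c) -> -1 <= k 1 0 <= -1 + 2.
Proof.
by move=> /msupp_laurent_form; rewrite !inE => /or4P[] /eqP ->; rewrite !vec2K.
Qed.

Lemma linear_form_value (K : fieldType) (j : {rmorphism C -> K}) X Y q a b c :
  form_value j X Y [:: (q, vec2 (-1) (-1)); (a, vec2 1 0); (b, vec2 0 1); (c, vec2 0 0)]
  = j q * (X^-1 * Y^-1) + j a * X + j b * Y + j c.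
Proof.
rewrite !form_value_cons form_value_nil -!invr_expz !expr1z !expr0z; ring.
Qed.

Lemma linear_form_pencil (K : fieldType) (j : {rmorphism C -> K}) (z X Y : K) e
    a b c a' b' c' :
  j 1 * z + j (a - e * a') * X + j (b - e * b') * Y + j (c - e * c') =
  j 1 * z + j a * X + j b * Y + j c - j e * (j 0 * z + j a' * X + j b' * Y + j c').
Proof. rewrite !rmorphB !rmorphM rmorph0; ring. Qed.

Lemma linear_form_neq0 q a b c : q != 0 -> linear_form q a b c != 0.
Proof.
apply: contra_neq => /(congr1 (mcoeff (vec2 (-1) (-1)))).
rewrite mcoeff_laurent_form !big_cons big_nil mcoeff0 /= eqxx.
have ne (u v : int) : (u, v) != (-1, -1) -> (vec2 u v == vec2 (-1) (-1)) = false.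
  by move=> uv; apply: contraNF uv => /eqP /(@vec2_inj (u, v) (-1, -1)) ->.
by rewrite !ne // !addr0.
Qed.

Let monomial_mul a b c d e g : a + c = e -> b + d = g ->
  monomial C (vec2 a b) * monomial C (vec2 c d) = monomial C (vec2 e g).
Proof. by move=> <- <-; rewrite -monomialD vec2D. Qed.

Lemma upsilon2_quadric (f : laurent C) :
  {subset msupp f <= [seq vec2 p.1 p.2 | p <- upsilon2_points]} ->
  let q a b := laurentC f@_(vec2 a b) in
  f = quadric (q (-2) (-2)) (q 0 (-1)) (q (-1) 0) (q (-1) (-1))
    (q 2 0) (q 1 1) (q 1 0) (q 0 2) (q 0 1) (q 0 0) z0 z1 z2.
Proof.
move=> fs q; rewrite [LHS](laurent_form_of_supp _ fs); last first.
  by rewrite map_inj_uniq //; exact: vec2_inj.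
rewrite [map _ _]/= !laurent_form_cons laurent_form_nil monomial00.
by apply: quadric_of_products; exact: monomial_mul.
Qed.

Section Bound.
Variable f : laurent C.
Hypothesis irrf : irreducible_elt f.
Hypothesis f_upsilon : forall m : 'cV[int]_2, m \in msupp f ->
  [/\ m 0 0 + m 1 0 <= 2, m 0 0 - 2 * m 1 0 <= 2 & m 1 0 - 2 * m 0 0 <= 2].
Hypothesis f_corner : vec2 (-2) (-2) \in msupp f.
Hypothesis f_top : vec2 0 2 \in msupp f.

Lemma upsilon2_factor : exists a1 a2 a3 b1 b2 b3 c1 c2 c3 d1 d2 d3,
  f = linear_form 1 a1 a2 a3 * linear_form f@_(vec2 (-2) (-2)) b1 b2 b3
      - linear_form 0 c1 c2 c3 * linear_form 0 d1 d2 d3.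
Proof.
have fs : {subset msupp f <= [seq vec2 p.1 p.2 | p <- upsilon2_points]}.
  move=> m /f_upsilon [h1 h2 h3]; rewrite (vec2_eta m).
  exact: (map_f (fun p : int * int => vec2 p.1 p.2) (mem_upsilon2 h1 h2 h3)).
have q0 : f@_(vec2 (-2) (-2)) != 0 by rewrite mcoeff_neq0.
have fE := upsilon2_quadric fs.
have [a1 [a2 [a3 [b1 [b2 [b3 [c1 [c2 [c3 [d1 [d2 [d3 [[e1 e2 e3] [e4 e5 e6] [e7 e8 e9]]]]]]]]]]]]]]
  := quadric_split two_neq0 f@_(vec2 0 (-1)) f@_(vec2 (-1) 0) f@_(vec2 (-1) (-1))
       f@_(vec2 2 0) f@_(vec2 1 1) f@_(vec2 1 0) f@_(vec2 0 2) f@_(vec2 0 1) f@_(vec2 0 0) q0.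
exists a1, a2, a3, b1, b2, b3, c1, c2, c3, d1, d2, d3.
rewrite !linear_formE; apply: etrans fE _ => /=.
by rewrite e1 e2 e3 e4 e5 e6 e7 e8 e9 quadric_identity.
Qed.

(** The heights of a linear form span at most 2, those of [f] span 4. *)
Lemma linear_form_not_zero (K : fieldType) (phi : {rmorphism laurent C -> K}) q a b c :
  is_function_field f phi -> phi (linear_form q a b c) = 0 -> linear_form q a b c = 0.
Proof.
move=> ff; apply: (@height_not_zero _ f irrf _ phi _ _ _ (-1) 2 ff f_top f_corner).
  by rewrite !vec2K.
exact: linear_form_height.
Qed.

(** One factor would be a unit, so [f] would divide the other one. *)
Lemma product_not_linear_forms q a b c q' a' b' c' :
  f <> linear_form q a b c * linear_form q' a' b' c'.
Proof.
move=> fE; have [K [phi ff]] := function_field_exists irrf.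
have phi0 g : divides f g -> phi g = 0 by apply: (((function_fieldP irrf phi).1 ff).1 g).2.
have f0 : f <> 0 by case: irrf.
case: (irrf) => _ _ /(_ _ _ fE) [[v lv]|[v lv]].
  apply: f0; rewrite fE (@linear_form_not_zero _ phi q' _ _ _ ff) ?mulr0 //.
  by apply: phi0; exists v; rewrite fE mulrAC lv mul1r.
apply: f0; rewrite fE (@linear_form_not_zero _ phi q _ _ _ ff) ?mul0r //.
by apply: phi0; exists v; rewrite fE -mulrA lv mulr1.
Qed.

(** Take for t a ruling l1 / l3 of the quadric. *)
Lemma upsilon2_bound : exists d, (d <= 3)%N /\ has_rational_map_of_degree f d.
Proof.
have [K [phi ff]] := function_field_exists irrf.
have [a1 [a2 [a3 [b1 [b2 [b3 [c1 [c2 [c3 [d1 [d2 [d3 fE]]]]]]]]]]]] := upsilon2_factor.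
set q0 := f@_ _ in fE.
have q00 : q0 != 0 by rewrite mcoeff_neq0.
pose l1 := phi (linear_form 1 a1 a2 a3); pose l2 := phi (linear_form q0 b1 b2 b3).
pose l3 := phi (linear_form 0 c1 c2 c3); pose l4 := phi (linear_form 0 d1 d2 d3).
have l30 : l3 != 0.
  apply/eqP => /(linear_form_not_zero ff) L3; apply: (@product_not_linear_forms 1 a1 a2 a3 q0 b1 b2 b3).
  by rewrite [LHS]fE L3 [X in _ - X = _]mul0r [LHS]subr0.
have phif : phi f = 0.
  by apply: (((function_fieldP irrf phi).1 ff).1 f).2; exists 1; rewrite mulr1.
have quad : l1 * l2 = l3 * l4.
  apply/eqP; rewrite -subr_eq0 /l1 /l2 /l3 /l4 -!(rmorphM phi) -(rmorphB phi) -fE phif.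
  exact: eqxx.
pose j := phi \o @laurentC C; pose x := phi (varx C); pose y := phi (vary C).
have unit_neq0 u : invertible_elt u -> phi u != 0.
  move=> [v uv]; apply/eqP => u0; have := congr1 phi uv.
  by rewrite (rmorphM phi) (rmorph1 phi) u0 mul0r => /esym/eqP; rewrite oner_eq0.
have x0 : x != 0 by apply: unit_neq0; apply: monomial_unit.
have y0 : y != 0 by apply: unit_neq0; apply: monomial_unit.
have lfE q a b c : phi (linear_form q a b c) =
    j q * (x^-1 * y^-1) + j a * x + j b * y + j c.
  by rewrite /linear_form rmorph_laurent_form linear_form_value.
pose t := l1 / l3.
have tC : ~ constants phi t.
  move=> [c _ ct].
  have /(linear_form_not_zero ff) : phi (linear_form 1 (a1 - c * c1) (a2 - c * c2) (a3 - c * c3)) = 0.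
    have -> : 0 = l1 - j c * l3 by rewrite [j c]ct mulfVK // subrr.
    by rewrite /l1 /l3 !lfE; apply: linear_form_pencil.
  by apply/eqP/linear_form_neq0/oner_neq0.
have t_trans p : p != 0 -> poly_eval j t p != 0.
  by apply: nonconstant_transcendental => c tc; apply: tC; exists c.
have wxy : (x^-1 * y^-1) * (x * y) = 1 by rewrite mulrACA (mulVf x0) (mulVf y0) mulr1.
have j1 : j 1 = 1 := rmorph1 (phi \o @laurentC C).
have j0 : j 0 = 0 := rmorph0 (phi \o @laurentC C).
have [] := @quadric_line C K j t t_trans q0 a1 a2 a3 b1 b2 b3 c1 c2 c3 d1 d2 d3
  (x^-1 * y^-1) x y l1 l2 l3 l4 wxy _ _ _ _ quad l30 erefl q00.
- by rewrite /l1 lfE j1 mul1r.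
- by rewrite /l2 lfE.
- by rewrite /l3 lfE j0 mul0r add0r.
- by rewrite /l4 lfE j0 mul0r add0r.
- move=> [P [[P0 Ps evP] [gx gy]]].
  have [d [dP hd]] := rational_map_bound ff tC P0 evP gx gy.
  by exists d; split; [apply: leq_trans dP _; case: (size P) Ps|exact: hd].
- move=> [P [[P0 Ps evP] [gx gy]]].
  have [d [dP hd]] := rational_map_bound ff tC P0 evP gx gy.
  by exists d; split; [apply: leq_trans dP _; case: (size P) Ps|exact: hd].
Qed.

End Bound.
End Upsilon.

(** * Z-affine changes of coordinates *)

Section RingAutomorphism.
Variables (A : comNzRingType) (sigma tau : {rmorphism A -> A}) (u : A).
Hypothesis tauK : cancel tau sigma.
Hypothesis sigmaK : cancel sigma tau.
Hypothesis u_unit : invertible_elt u.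

Lemma rmorph_invertible (phi : {rmorphism A -> A}) v :
  invertible_elt v -> invertible_elt (phi v).
Proof. by move=> [w vw]; exists (phi w); rewrite -rmorphM vw rmorph1. Qed.

Lemma irreducible_automorphism f : irreducible_elt f -> irreducible_elt (u * tau f).
Proof.
have [v uv] := u_unit; have sU : sigma v * sigma u = 1 by rewrite -rmorphM mulrC uv rmorph1.
move=> [f0 fU firr]; split.
- move=> e; apply: f0; rewrite -[f]tauK -[tau f]mul1r -uv mulrAC e mul0r.
  exact: rmorph0.
- move=> /(rmorph_invertible sigma); rewrite rmorphM tauK => -[w fw]; apply: fU.
  by exists (sigma u * w); rewrite mulrA [f * _]mulrC.
move=> g h e; have : f = sigma (v * g) * sigma h.
  by rewrite -rmorphM -mulrA -e mulrA [v * u]mulrC uv mul1r tauK.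
move=> /firr [] /(rmorph_invertible tau); rewrite sigmaK; last by right.
move=> vg; left; rewrite -[g]mul1r -uv -mulrA; exact: invertibleM.
Qed.

Lemma divides_automorphism f g : divides (u * tau f) (tau g) <-> divides f g.
Proof.
split=> -[q e]; last first.
  have [v uv] := u_unit; exists (v * tau q).
  by rewrite e rmorphM mulrACA uv mul1r.
by exists (sigma u * sigma q); rewrite -[g]tauK e !rmorphM tauK mulrA [sigma u * f]mulrC.
Qed.

Lemma residue_field_automorphism f (K : fieldType) (phi : {rmorphism A -> K}) :
  (forall g, phi g = 0 <-> divides (u * tau f) g) ->
  (forall z, exists g h, phi h != 0 /\ z = phi g / phi h) ->
  (forall g, (phi \o tau) g = 0 <-> divides f g) /\
  (forall z, exists g h, (phi \o tau) h != 0 /\ z = (phi \o tau) g / (phi \o tau) h).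
Proof.
move=> phi0 frac; split=> [g|z].
  by rewrite /= phi0; apply: divides_automorphism.
have [g [h [h0 ->]]] := frac z; exists (sigma g), (sigma h).
by rewrite /= !sigmaK.
Qed.
End RingAutomorphism.

Section MonomialChange.
Variable C : closedFieldType.
Implicit Types (f g : laurent C) (m b k : 'cV[int]_2) (M : 'M[int]_2).

Section Twist.
Variable M : 'M[int]_2.
Let h m := monomial C (M *m m).
Let hD m n : h (m + n) = h m * h n.
Proof. by rewrite /h mulmxDr monomialD. Qed.
Let h0 : h 0 = 1. Proof. by rewrite /h mulmx0 monomial0. Qed.

(** The monomial automorphism that acts on exponents by [M]. *)
Definition twist : {rmorphism laurent C -> laurent C} :=
  HB.pack (mmap (@laurentC C) h : laurent C -> laurent C)
    (GRing.isZmodMorphism.Build _ _ _ (laurent_subst_zmod_morphism (@laurentC C) h))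
    (GRing.isMonoidMorphism.Build _ _ _
       (laurent_subst_monoid_morphism (@laurentC C) h0 hD)).

Lemma twist_term c m : twist << c *g m >> = << c *g M *m m >>.
Proof. by rewrite [LHS]laurent_subst_term [RHS]termE. Qed.

Lemma twist_laurentC c : twist (laurentC c) = laurentC c.
Proof. by have := twist_term c 0; rewrite mulmx0. Qed.

Lemma twistE g : twist g = \sum_(m <- msupp g) << g@_m *g M *m m >>.
Proof.
rewrite [in LHS](monalgE g) [LHS]rmorph_sum; apply: eq_bigr => m _; exact: twist_term.
Qed.
End Twist.

Lemma twistK M M' : M' *m M = 1%:M -> cancel (twist M) (twist M').
Proof.
move=> MM g; rewrite (twistE M g) [LHS]rmorph_sum [RHS]monalgE.
by apply: eq_bigr => m _; rewrite [LHS]twist_term mulmxA MM mul1mx.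
Qed.

Variables (M : 'M[int]_2) (b : 'cV[int]_2).
Hypothesis M_unit : M \in unitmx.

Definition affine_change f := monomial C b * twist M f.

Lemma msupp_affine_change f m :
  (M *m m + b \in msupp (affine_change f)) = (m \in msupp f).
Proof.
rewrite msupp_monomialM addrK -!mcoeff_neq0; congr (_ != _).
rewrite twistE raddf_sum /= -[RHS]sum_mcoeff_eq; apply: eq_bigr => k _.
by rewrite mcoeffU (inj_eq (can_inj (mulKmx M_unit))).
Qed.

Lemma msupp_affine_changeP f k : k \in msupp (affine_change f) ->
  exists2 m, m \in msupp f & k = M *m m + b.
Proof.
have kE : k = M *m (invmx M *m (k - b)) + b by rewrite mulKVmx // subrK.
by rewrite {1}kE msupp_affine_change => kf; exists (invmx M *m (k - b)).
Qed.

Lemma irreducible_affine_change f : irreducible_elt f -> irreducible_elt (affine_change f).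
Proof.
apply: (irreducible_automorphism (twistK (mulVmx M_unit)) (twistK (mulmxV M_unit))).
exact: monomial_unit.
Qed.

Lemma rational_map_affine_change f d : irreducible_elt f ->
  has_rational_map_of_degree (affine_change f) d -> has_rational_map_of_degree f d.
Proof.
move=> irrf [K [phi [t [ff tC ext]]]].
have [phi0 frac] := (function_fieldP (irreducible_affine_change irrf) phi).1 ff.
have jE : (fun c => (phi \o twist M) (laurentC c)) = (fun c => phi (laurentC c)).
  by apply: funext => c; rewrite /= twist_laurentC.
exists K, (phi \o twist M), t; split.
- apply/(function_fieldP irrf).
  exact: (residue_field_automorphism (twistK (mulVmx M_unit)) (twistK (mulmxV M_unit))
    (monomial_unit C b) phi0 frac).
- by move=> [c _ e]; apply: tC; exists c; rewrite // -e -[RHS]/((fun c => (phi \o twist M) (laurentC c)) c) jE.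
- by rewrite /simple_subfield /eval_in jE.
Qed.
End MonomialChange.

(** * Convex hulls, Minkowski multiples and the lattice width *)

Section ConvexHulls.
Variable R : realType.
Implicit Types (A : set 'cV[R]_2) (x p : 'cV[R]_2) (al be c : R).

Definition functional al be x : R := al * x 0 0 + be * x 1 0.

Lemma functional_sum (I : Type) (r : seq I) al be (F : I -> 'cV[R]_2) :
  functional al be (\sum_(i <- r) F i) = \sum_(i <- r) functional al be (F i).
Proof. by rewrite /functional !summxE !mulr_sumr -big_split. Qed.

Lemma functionalZ al be a x : functional al be (a *: x) = a * functional al be x.
Proof. by rewrite /functional !mxE; ring. Qed.

Lemma functionalB al be x p :
  functional al be (x - p) = functional al be x - functional al be p.
Proof. by rewrite /functional !mxE; ring. Qed.

Lemma sub_conv_hull A x : A x -> conv_hull A x.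
Proof.
move=> Ax; exists 1%N, (fun=> x), (fun=> 1); split=> //.
  by rewrite big_ord1.
by rewrite big_ord1 scale1r.
Qed.

Lemma conv_hull_le A al be c : (forall p, A p -> functional al be p <= c) ->
  forall x, conv_hull A x -> functional al be x <= c.
Proof.
move=> Ac x [n [p [w [pA w0 w1 ->]]]]; rewrite functional_sum.
rewrite -[c]mul1r -w1 mulr_suml; apply: ler_sum => i _.
by rewrite functionalZ ler_wpM2l // Ac.
Qed.

(** If all points of [A] were strictly below [c], so would be their barycenters. *)
Lemma conv_hull_extreme A al be c x : (forall p, A p -> functional al be p <= c) ->
  conv_hull A x -> functional al be x = c ->
  exists2 p, A p & functional al be p = c.
Proof.
move=> Ac [n [p [w [pA w0 w1 ->]]]] xc; apply: contrapT => no.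
have lt i : functional al be (p i) < c.
  by rewrite lt_neqAle Ac // andbT; apply/eqP => pc; apply: no; exists (p i).
have: \sum_i w i * (c - functional al be (p i)) = 0.
  under eq_bigr => i _ do rewrite mulrBr.
  rewrite sumrB -mulr_suml w1 mul1r -xc functional_sum.
  by under eq_bigr => i _ do rewrite functionalZ; rewrite subrr.
move=> /eqP; rewrite psumr_eq0 => [/allP w00|i _]; last first.
  by rewrite mulr_ge0 // subr_ge0 ltW.
have: \sum_i w i = 0.
  apply: big1 => i _; have := w00 i (mem_index_enum i).
  by rewrite mulf_eq0 subr_eq0 (gt_eqF (lt i)) orbF => /eqP.
by rewrite w1 => /eqP; rewrite oner_eq0.
Qed.

Lemma minkowski_le A al be c (d : nat) : (forall p, A p -> functional al be p <= c) ->
  forall x, minkowski_multiple d A x -> functional al be x <= d%:R * c.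
Proof.
move=> Ac x [p [pA ->]]; rewrite functional_sum.
apply: le_trans (ler_sum _ (fun i _ => Ac _ (pA i))) _.
by rewrite sumr_const card_ord mulr_natl.
Qed.

Lemma minkowski_point A x (d : nat) : A x -> minkowski_multiple d A (d%:R *: x).
Proof.
by move=> Ax; exists (fun=> x); split=> //; rewrite sumr_const card_ord scaler_nat.
Qed.

Lemma conv_hull_Zaffine M b A x :
  conv_hull A x -> conv_hull (Zaffine M b @` A) (Zaffine M b x).
Proof.
move=> [n [p [w [pA w0 w1 ->]]]]; exists n, (fun i => Zaffine M b (p i)), w; split=> //.
  by move=> i; exists (p i).
rewrite /Zaffine mulmx_sumr; under [RHS]eq_bigr => i _ do rewrite scalerDr.
rewrite big_split /= -scaler_suml w1 scale1r; congr (_ + _).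
by apply: eq_bigr => i _; rewrite scalemxAr.
Qed.

Lemma Zaffine_int M b (m : 'cV[int]_2) :
  Zaffine M b (map_mx intr m) = map_mx intr (M *m m + b) :> 'cV[R]_2.
Proof. by rewrite /Zaffine map_mxD map_mxM. Qed.

Lemma lattice_widthP A : (exists s, fits_in_strip A s) ->
  fits_in_strip A (lattice_width A).
Proof.
move=> [s As]; rewrite /lattice_width.
set P := [set s | _].
have [] : P (xget 0%N P); last by [].
apply: xgetPex; have ex : exists n, `[< fits_in_strip A n >] by exists s; apply/asboolP.
case: (ex_minnP ex) => n /asboolP An minn; exists n; split=> // s' As'.
by apply: minn; apply/asboolP.
Qed.
End ConvexHulls.

Lemma mul22_row (T : comNzRingType) (M : 'M[T]_2) (v : 'cV[T]_2) i :
  (M *m v) i 0 = M i 0 * v 0 0 + M i 1 * v 1 0.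
Proof.
rewrite mxE !big_ord_recl big_ord0 addr0; congr (_ * _ + M _ _ * v _ _); exact: val_inj.
Qed.

Lemma unitmx_row_neq0 (M : 'M[int]_2) : M \in unitmx -> (M 1 0 != 0) || (M 1 1 != 0).
Proof.
move=> MU; rewrite -negb_and; apply/negP => /andP[/eqP M0 /eqP M1].
have := mulmxV MU => /(congr1 (fun N : 'M_2 => N 1 1)).
rewrite mxE !big_ord_recl big_ord0 addr0.
have -> : lift ord0 ord0 = 1 :> 'I_2 by exact: val_inj.
by rewrite M0 M1 !mul0r mxE.
Qed.

(** * Newton polygons and lattice directions *)

Section NewtonPolygon.
Variable R : realType.
Implicit Types (f : laurent R[i]) (m k b : 'cV[int]_2) (M : 'M[int]_2).
Local Notation real_vec := (map_mx intr : 'cV[int]_2 -> 'cV[R]_2).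

Lemma newton_supp f m : m \in msupp f -> newton_polygon f (real_vec m).
Proof. by move=> mf; apply: sub_conv_hull; exists m. Qed.

Lemma functional_int (n0 n1 : int) m :
  functional n0%:~R n1%:~R (real_vec m) = (n0 * m 0 0 + n1 * m 1 0)%:~R.
Proof. by rewrite /functional !mxE rmorphD !rmorphM. Qed.

Lemma newton_le f (n0 n1 c : int) :
  (forall m, m \in msupp f -> n0 * m 0 0 + n1 * m 1 0 <= c) ->
  forall x, newton_polygon f x -> functional n0%:~R n1%:~R x <= c%:~R.
Proof.
move=> fc; apply: conv_hull_le => _ [m mf <-].
by rewrite functional_int ler_int; apply: fc.
Qed.

(** [conv_hull_extreme] provides a point of the support at which the functional
    reaches its maximum. *)
Lemma newton_vertex f (n0 n1 : int) v : newton_polygon f (real_vec v) ->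
  (forall m, m \in msupp f -> n0 * m 0 0 + n1 * m 1 0 <= n0 * v 0 0 + n1 * v 1 0) ->
  (forall m, m \in msupp f -> n0 * m 0 0 + n1 * m 1 0 = n0 * v 0 0 + n1 * v 1 0 -> m = v) ->
  v \in msupp f.
Proof.
move=> vf fle feq; have [||_ [m mf <-]] := conv_hull_extreme
  (al := n0%:~R) (be := n1%:~R) (c := (n0 * v 0 0 + n1 * v 1 0)%:~R) _ vf.
- by move=> _ [m mf <-]; rewrite functional_int ler_int; apply: fle.
- exact: functional_int.
by rewrite functional_int => /intr_inj /(feq m mf) <-.
Qed.

Lemma newton_affine_change f M b x : M \in unitmx ->
  newton_polygon f x -> newton_polygon (affine_change M b f) (Zaffine M b x).
Proof.
move=> MU /(conv_hull_Zaffine M b) [n [p [w [pA w0 w1 ->]]]].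
exists n, p, w; split=> // i; have [_ [m mf <-] <-] := pA i.
exists (M *m m + b); last by rewrite Zaffine_int.
by rewrite /= msupp_affine_change.
Qed.

Lemma height_bound f : exists N : nat, forall m, m \in msupp f -> `|m 1 0| <= N%:Z.
Proof.
exists (\sum_(m <- msupp f) `|m 1%R 0%R|)%N => m mf.
by rewrite (big_fsetD1 m) //= -abszE lez_nat leq_addr.
Qed.

Lemma newton_fits f : exists s, fits_in_strip (newton_polygon f) s.
Proof.
have [N fN] := height_bound f.
exists (N + N)%N, 1%:M, (vec2 0 N%:Z); split; first exact: unitmx1.
move=> _ [x fx <-]; rewrite /mkset /Zaffine map_mx1 mul1mx !mxE /=.
have h1 : functional 0%:~R (-1)%:~R x <= N%:Z%:~R.
  apply: (newton_le _ fx) => m /fN; rewrite mul0r add0r mulN1r ler_norml lerNl.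
  by case/andP.
have h2 : functional 0%:~R 1%:~R x <= N%:Z%:~R.
  apply: (newton_le _ fx) => m /fN; rewrite mul0r add0r mul1r ler_norml.
  by case/andP.
move: h1 h2; rewrite /functional !mul0r !add0r mulrN1z mulN1r mul1r -pmulrn => h1 h2.
by rewrite natrD; split; rewrite ?lerD2r // -lerBlDr sub0r lerNl.
Qed.

Lemma fits_supp f s : fits_in_strip (newton_polygon f) s ->
  exists M b, M \in unitmx /\ forall k, k \in msupp (affine_change M b f) -> 0 <= k 1 0 <= s%:Z.
Proof.
move=> [M [b [MU strip]]]; exists M, b; split=> // k.
move=> /(msupp_affine_changeP MU) [m mf ->].
have /strip [] : (Zaffine M b @` newton_polygon f) (Zaffine M b (real_vec m)).
  by exists (real_vec m) => //; apply: newton_supp.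
by rewrite Zaffine_int !mxE ler0z -[s%:R]/(s%:Z%:~R) ler_int => -> ->.
Qed.

(** If all exponents had the same height, a nonzero row of [M] would be orthogonal
    to two independent differences of points of the polygon. *)
Lemma two_dimensional_heights f M b : M \in unitmx -> two_dimensional (newton_polygon f) ->
  exists k k', [/\ k \in msupp (affine_change M b f), k' \in msupp (affine_change M b f) &
    k' 1 0 < k 1 0].
Proof.
move=> MU [p [q [r [fp fq fr dt]]]]; apply: contrapT => no.
have heightE m : (M *m m + b) 1 0 = M 1 0 * m 0 0 + M 1 1 * m 1 0 + b 1 0.
  by rewrite -mul22_row mxE.
have eqh m m' : m \in msupp f -> m' \in msupp f ->
    M 1 0 * m 0 0 + M 1 1 * m 1 0 <= M 1 0 * m' 0 0 + M 1 1 * m' 1 0.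
  move=> mf m'f; rewrite leNgt; apply/negP => lt.
  apply: no; exists (M *m m + b), (M *m m' + b).
  by rewrite !msupp_affine_change // !heightE ltrD2r.
have [m0 m0f] : exists m, m \in msupp f.
  have [n [p' [w [pA _ w1 _]]]] := fp; case: n p' w pA w1 => [|n] p' w pA w1.
    by move: w1; rewrite big_ord0 => /esym/eqP; rewrite oner_eq0.
  by have [m mf _] := pA ord0; exists m.
pose c := M 1 0 * m0 0 0 + M 1 1 * m0 1 0.
have const x : newton_polygon f x -> functional (M 1 0)%:~R (M 1 1)%:~R x = c%:~R.
  move=> fx; apply/eqP; rewrite eq_le (newton_le (fun m mf => eqh m m0 mf m0f) fx) /=.
  have : functional (- M 1 0)%:~R (- M 1 1)%:~R x <= (- c)%:~R.
    apply: (newton_le _ fx) => m mf; rewrite !mulNr -opprD lerN2; exact: eqh.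
  by rewrite /functional !mulrNz !mulNr -opprD lerN2.
pose v := row 1 (map_mx intr M : 'M[R]_2).
have vE u : functional (M 1 0)%:~R (M 1 1)%:~R u = 0 -> v *m u = 0.
  move=> u0; apply/matrixP => i j; rewrite !ord1 mxE !big_ord_recl big_ord0 addr0 !mxE -[RHS]u0.
  by rewrite /functional; congr ((M _ _)%:~R * u _ _ + (M _ _)%:~R * u _ _); exact: val_inj.
have vD : v *m (row_mx (q - p) (r - p) : 'M[R]_(1 + 1)) = 0.
  rewrite mul_mx_row !vE ?row_mx0 // functionalB !const //; exact: subrr.
have v0 : v = 0.
  have DU : (row_mx (q - p) (r - p) : 'M[R]_(1 + 1)) \in unitmx by rewrite unitmxE unitfE.
  by rewrite -[v](mulmxK DU) vD mul0mx.
have := unitmx_row_neq0 MU; have v0E j := congr1 (fun u : 'rV_2 => u 0 j) v0.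
have := v0E 0; have := v0E 1; rewrite /v !mxE => /eqP; rewrite intr_eq0 => ->.
by move=> /eqP; rewrite intr_eq0 => ->.
Qed.

(** A single term is a unit. *)
Lemma two_exponents f : irreducible_elt f ->
  exists m m', [/\ m \in msupp f, m' \in msupp f & m != m'].
Proof.
move=> irrf; case: (irrf) => f0 fU _.
case E : (msupp f : seq _) => [|m r]; first by case: f0; rewrite [f]monalgE E big_nil.
have mE k : (k \in msupp f) = (k \in m :: r) by rewrite -E.
have mf : m \in msupp f by rewrite mE mem_head.
case: r E mE => [|m' r] E mE.
  case: fU; rewrite [f]monalgE E big_seq1 termE; apply: invertibleM.
    exists (laurentC (f@_m)^-1); rewrite -rmorphM mulfV ?rmorph1 //.
    by rewrite mcoeff_neq0.
  exact: monomial_unit.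
exists m, m'; split=> //; first by rewrite mE !inE eqxx orbT.
by have := fset_uniq (msupp f); rewrite E /= inE negb_or => /andP[/andP[]].
Qed.

(** Some coordinate takes two values on the support; up to exchanging the
    coordinates, [strip_bound] applies in a strip that is high enough. *)
Lemma exists_rational_map f : irreducible_elt f -> exists d, has_rational_map_of_degree f d.
Proof.
move=> irrf; have [m [m' [mf m'f mm']]] := two_exponents irrf.
have [M [MU Mmm']] : exists M : 'M[int]_2, M \in unitmx /\ (M *m m) 1 0 != (M *m m') 1 0.
  have [e1|] := eqVneq (m 1 0) (m' 1 0); last by exists 1%:M; rewrite unitmx1 !mul1mx.
  (* The matrix that exchanges the coordinates. *)
  pose M : 'M[int]_2 := \matrix_(i, j) (i != j)%:R.
  exists M; split.
    have MM : M *m M = 1%:M.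
      apply/matrixP => i j; rewrite !mxE !big_ord_recl big_ord0 !mxE.
      by case: i j => [[|[|//]] ?] [[|[|//]] ?].
    by case: (mulmx1_unit MM).
  rewrite !mul22_row !mxE /= !mul1r !mul0r !addr0; apply: contra_neq mm' => e0.
  exact: vec2Z_eqP.
have [N fN] := height_bound (twist _ M f).
pose f' := affine_change M (vec2 0 N%:Z) f.
have irrf' : irreducible_elt f' := irreducible_affine_change _ MU irrf.
have hf' k : k \in msupp f' -> 0 <= k 1 0 <= (N + N)%N%:Z.
  rewrite msupp_monomialM => /fN; rewrite !mxE /= ler_norml => /andP[].
  move: (k 1 0 : int) => h; clear; lia.
pose a := M *m m + vec2 0 N%:Z; pose a' := M *m m' + vec2 0 N%:Z.
have af : a \in msupp f' by rewrite msupp_affine_change.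
have a'f : a' \in msupp f' by rewrite msupp_affine_change.
have : (a 1 0 < a' 1 0) || (a' 1 0 < a 1 0).
  have hE u : (M *m u + vec2 0 N%:Z) 1 0 = (M *m u) 1 0 + N%:Z.
    by rewrite [LHS]mxE vec2_1.
  by rewrite -neq_lt /a /a' !hE (inj_eq (addIr _)).
case/orP => lt.
  by have [d [_ /(rational_map_affine_change MU irrf) hd]] := strip_bound irrf' hf' a'f af lt; exists d.
by have [d [_ /(rational_map_affine_change MU irrf) hd]] := strip_bound irrf' hf' af a'f lt; exists d.
Qed.

End NewtonPolygon.

(** * Widths and vertices of the special polygons, and the theorem *)

Section SpecialPolygons.
Variable R : realType.
Implicit Types (f : laurent R[i]) (m k b : 'cV[int]_2) (M : 'M[int]_2).
Local Notation real_vec := (map_mx intr : 'cV[int]_2 -> 'cV[R]_2).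

Lemma real_vec2 (a c : int) : real_vec (vec2 a c) = vec2 a%:~R c%:~R.
Proof. by apply: vec2_eqP; rewrite !mxE. Qed.

Definition triangle (v0 v1 v2 : 'cV[int]_2) : set 'cV[R]_2 :=
  conv_hull [set real_vec v0; real_vec v1; real_vec v2].

Lemma SigmaE : Sigma R = triangle (vec2 0 0) (vec2 1 0) (vec2 0 1).
Proof. by rewrite /triangle !real_vec2. Qed.

Lemma UpsilonE : Upsilon R = triangle (vec2 (-1) (-1)) (vec2 1 0) (vec2 0 1).
Proof. by rewrite /triangle !real_vec2 mulrN1z. Qed.

Lemma triangle_multiple_le (v0 v1 v2 : 'cV[int]_2) (d : nat) (n0 n1 c : int) k :
  n0 * v0 0 0 + n1 * v0 1 0 <= c -> n0 * v1 0 0 + n1 * v1 1 0 <= c ->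
  n0 * v2 0 0 + n1 * v2 1 0 <= c ->
  minkowski_multiple d (triangle v0 v1 v2) (real_vec k) ->
  n0 * k 0 0 + n1 * k 1 0 <= d%:Z * c.
Proof.
move=> h0 h1 h2 dk; rewrite -(ler_int R) -functional_int rmorphM /= -pmulrn.
apply: minkowski_le dk; apply: conv_hull_le.
by move=> _ [[->|->]|->]; rewrite functional_int ler_int.
Qed.

Lemma triangle_multiple_vertex (v0 v1 v2 : 'cV[int]_2) (d : nat) v :
  v = v0 \/ v = v1 \/ v = v2 ->
  minkowski_multiple d (triangle v0 v1 v2) (real_vec (d%:Z *: v)).
Proof.
move=> vE; have -> : real_vec (d%:Z *: v) = d%:R *: real_vec v.
  by apply/matrixP => i j; rewrite !mxE rmorphM.
apply: minkowski_point; apply: sub_conv_hull.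
by case: vE => [->|[->|->]]; [left; left|left; right|right].
Qed.

Lemma equivalent_supp f A M b k : M \in unitmx ->
  Zaffine M b @` newton_polygon f = A -> k \in msupp (affine_change M b f) ->
  A (real_vec k).
Proof.
move=> MU <- /(msupp_affine_changeP MU) [m mf ->]; exists (real_vec m).
  exact: newton_supp.
exact: Zaffine_int.
Qed.

Lemma equivalent_newton f A M b x : M \in unitmx ->
  Zaffine M b @` newton_polygon f = A -> A x -> newton_polygon (affine_change M b f) x.
Proof. by move=> MU <- [y fy <-]; apply: newton_affine_change. Qed.

(** The height in any other system of coordinates is an integral affine
    functional, which is not constant. *)
Lemma fits_affine_change f s M b : M \in unitmx -> fits_in_strip (newton_polygon f) s ->
  exists n0 n1 e : int, (n0 != 0) || (n1 != 0) /\
    forall k, k \in msupp (affine_change M b f) -> 0 <= n0 * k 0 0 + n1 * k 1 0 + e <= s%:Z.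
Proof.
move=> MU /fits_supp [M' [b' [M'U strip]]]; pose N := M' *m invmx M.
have NU : N \in unitmx by rewrite unitmx_mul M'U unitmx_inv.
exists (N 1 0), (N 1 1), ((b' - N *m b) 1 0); split; first exact: unitmx_row_neq0.
move=> k /(msupp_affine_changeP MU) [m mf ->].
have -> : N 1 0 * (M *m m + b) 0 0 + N 1 1 * (M *m m + b) 1 0 + (b' - N *m b) 1 0
    = (M' *m m + b') 1 0.
  rewrite -mul22_row; transitivity ((N *m (M *m m + b) + (b' - N *m b)) 1 0).
    by rewrite [RHS]mxE.
  by rewrite mulmxDr mulmxA mulmxKV // addrACA subrr addr0.
by apply: strip; rewrite msupp_affine_change.
Qed.

(** The vertices of the polygon are exponents of the Laurent polynomial.  On the
    three of them a nonconstant integral functional takes values at distance at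
    least [d], which bounds the lattice width from below. *)
Lemma simplex_width f (d : nat) M b s : M \in unitmx ->
  Zaffine M b @` newton_polygon f = minkowski_multiple d (Sigma R) ->
  let f' := affine_change M b f in
  [/\ nonneg_supp f', forall m, m \in msupp f' -> m 0 0 + m 1 0 <= d%:Z,
      vec2 0 d%:Z \in msupp f', vec2 0 0 \in msupp f' &
      fits_in_strip (newton_polygon f) s -> (d <= s)%N].
Proof.
rewrite SigmaE => MU E f'.
have sE k := equivalent_supp MU E (k := k).
have k0 k : k \in msupp f' -> 0 <= k 0 0.
  by move=> /sE /(@triangle_multiple_le _ _ _ _ (-1) 0 0); rewrite !vec2K; lia.
have k1 k : k \in msupp f' -> 0 <= k 1 0.
  by move=> /sE /(@triangle_multiple_le _ _ _ _ 0 (-1) 0); rewrite !vec2K; lia.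
have k01 k : k \in msupp f' -> k 0 0 + k 1 0 <= d%:Z.
  by move=> /sE /(@triangle_multiple_le _ _ _ _ 1 1 1); rewrite !vec2K; lia.
have vertex v : v = vec2 0 0 \/ v = vec2 1 0 \/ v = vec2 0 1 ->
    newton_polygon f' (real_vec (d%:Z *: v)).
  by move=> vE; apply: (equivalent_newton MU E); apply: triangle_multiple_vertex.
have sc (a c : int) : d%:Z *: vec2 a c = vec2 (d%:Z * a) (d%:Z * c).
  by apply: vec2Z_eqP; rewrite !mxE.
have f00 : vec2 0 0 \in msupp f'.
  have := vertex (vec2 0 0) (or_introl erefl); rewrite sc mulr0.
  move=> /(newton_vertex (n0 := -1) (n1 := -1)); rewrite !vec2K; apply.
    by move=> m mf; have := k0 _ mf; have := k1 _ mf; lia.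
  by move=> m mf e; apply: vec2Z_eqP; rewrite !vec2K; have := k0 _ mf; have := k1 _ mf; lia.
have f0d : vec2 0 d%:Z \in msupp f'.
  have := vertex (vec2 0 1) (or_intror (or_intror erefl)); rewrite sc mulr0 mulr1.
  move=> /(newton_vertex (n0 := 0) (n1 := 1)); rewrite !vec2K; apply.
    by move=> m mf; have := k0 _ mf; have := k01 _ mf; lia.
  by move=> m mf e; apply: vec2Z_eqP; rewrite !vec2K; have := k0 _ mf; have := k01 _ mf; lia.
have fd0 : vec2 d%:Z 0 \in msupp f'.
  have := vertex (vec2 1 0) (or_intror (or_introl erefl)); rewrite sc mulr0 mulr1.
  move=> /(newton_vertex (n0 := 1) (n1 := 0)); rewrite !vec2K; apply.
    by move=> m mf; have := k1 _ mf; have := k01 _ mf; lia.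
  by move=> m mf e; apply: vec2Z_eqP; rewrite !vec2K; have := k1 _ mf; have := k01 _ mf; lia.
split=> //; first by move=> k kf; split; [exact: k0|exact: k1].
move=> /(fits_affine_change b MU) [n0 [n1 [e [nz strip]]]].
have := strip _ f00; have := strip _ f0d; have := strip _ fd0; rewrite !vec2K !mulr0.
move: nz; clear; nia.
Qed.

(** Same argument as for [simplex_width]; in a strip of height at most 3 the
    three vertices would force both coefficients of the functional to vanish. *)
Lemma upsilon2_width f M b s : M \in unitmx ->
  Zaffine M b @` newton_polygon f = minkowski_multiple 2 (Upsilon R) ->
  let f' := affine_change M b f in
  [/\ forall m, m \in msupp f' ->
        [/\ m 0 0 + m 1 0 <= 2, m 0 0 - 2 * m 1 0 <= 2 & m 1 0 - 2 * m 0 0 <= 2],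
      vec2 (-2) (-2) \in msupp f', vec2 0 2 \in msupp f' &
      fits_in_strip (newton_polygon f) s -> (4 <= s)%N].
Proof.
rewrite UpsilonE => MU E f'.
have sE k := equivalent_supp MU E (k := k).
have ineq k : k \in msupp f' ->
    [/\ k 0 0 + k 1 0 <= 2, k 0 0 - 2 * k 1 0 <= 2 & k 1 0 - 2 * k 0 0 <= 2].
  move=> /sE kE; split.
  - by have := @triangle_multiple_le _ _ _ _ 1 1 1 _ _ _ _ kE; rewrite !vec2K; lia.
  - by have := @triangle_multiple_le _ _ _ _ 1 (-2) 1 _ _ _ _ kE; rewrite !vec2K; lia.
  - by have := @triangle_multiple_le _ _ _ _ (-2) 1 1 _ _ _ _ kE; rewrite !vec2K; lia.
have vertex v : v = vec2 (-1) (-1) \/ v = vec2 1 0 \/ v = vec2 0 1 ->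
    newton_polygon f' (real_vec (2%:Z *: v)).
  by move=> vE; apply: (equivalent_newton MU E); apply: triangle_multiple_vertex.
have sc (a c : int) : 2%:Z *: vec2 a c = vec2 (2 * a) (2 * c).
  by apply: vec2Z_eqP; rewrite !mxE.
have fc : vec2 (-2) (-2) \in msupp f'.
  have := vertex (vec2 (-1) (-1)) (or_introl erefl); rewrite sc.
  move=> /(newton_vertex (n0 := -1) (n1 := -1)); rewrite !vec2K; apply.
    by move=> m /ineq [? ? ?]; lia.
  by move=> m /ineq [? ? ?] e; apply: vec2Z_eqP; rewrite !vec2K; lia.
have ft : vec2 0 2 \in msupp f'.
  have := vertex (vec2 0 1) (or_intror (or_intror erefl)); rewrite sc mulr0 mulr1.
  move=> /(newton_vertex (n0 := -1) (n1 := 2)); rewrite !vec2K; apply.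
    by move=> m /ineq [? ? ?]; lia.
  by move=> m /ineq [? ? ?] e; apply: vec2Z_eqP; rewrite !vec2K; lia.
have fr : vec2 2 0 \in msupp f'.
  have := vertex (vec2 1 0) (or_intror (or_introl erefl)); rewrite sc mulr0 mulr1.
  move=> /(newton_vertex (n0 := 2) (n1 := -1)); rewrite !vec2K; apply.
    by move=> m /ineq [? ? ?]; lia.
  by move=> m /ineq [? ? ?] e; apply: vec2Z_eqP; rewrite !vec2K; lia.
split=> //; move=> /(fits_affine_change b MU) [n0 [n1 [e [nz strip]]]].
have := strip _ fc; have := strip _ ft; have := strip _ fr; rewrite !vec2K !mulr0.
move: nz; clear; lia.
Qed.

End SpecialPolygons.

Theorem theorem3 (R : realType) (f : laurent R[i]) (hf : irreducible_elt f) :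
  exists g : nat,
    [/\ is_gonality f g,
        two_dimensional (newton_polygon f) ->
          (g <= lattice_width (newton_polygon f))%N &
        ((exists d : nat, (2 <= d)%N /\
            equivalent (newton_polygon f) (minkowski_multiple d (Sigma R))) \/
         equivalent (newton_polygon f) (minkowski_multiple 2 (Upsilon R))) ->
          (g <= lattice_width (newton_polygon f) - 1)%N].
Proof.
have ex : exists d, `[< has_rational_map_of_degree f d >].
  by have [d hd] := exists_rational_map hf; exists d; apply/asboolP.
case: (ex_minnP ex) => g /asboolP hg gmin.
have gle d : has_rational_map_of_degree f d -> (g <= d)%N.
  by move=> hd; apply: gmin; apply/asboolP.
have fits := lattice_widthP (newton_fits f).
exists g; split; first by split.
- move=> dim2; have [M [b [MU strip]]] := fits_supp fits.
  have [k [k' [kf k'f k'k]]] := two_dimensional_heights b MU dim2.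
  have [d [dw hd]] := strip_bound (irreducible_affine_change b MU hf) strip kf k'f k'k.
  by apply: leq_trans dw; apply: gle; apply: rational_map_affine_change hd.
- move=> [[d [d2 [M [b [MU E]]]]]|[M [b [MU E]]]].
    have [f_pos f_deg f0d f00 /(_ fits) dw] := simplex_width (lattice_width (newton_polygon f)) MU E.
    have [e [ed he]] := simplex_bound (irreducible_affine_change b MU hf) d2 f_pos f_deg f0d f00.
    apply: leq_trans (leq_sub2r 1 dw); apply: leq_trans ed; apply: gle.
    exact: rational_map_affine_change he.
  have [f_ups fc ft /(_ fits) dw] := upsilon2_width (lattice_width (newton_polygon f)) MU E.
  have two0 : (2%:R : R[i]) != 0 by rewrite pnatr_eq0.
  have [e [e3 he]] := upsilon2_bound two0 (irreducible_affine_change b MU hf) f_ups fc ft.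
  apply: leq_trans (leq_sub2r 1 dw); apply: leq_trans e3; apply: gle.
  exact: rational_map_affine_change he.
Qed.
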